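(* For every $n\in\mathbb N$, let $\Gamma(n)=(\Omega(n),\mathcal X(n))$ be a hypergraph and let $\mathbf p(n)=(p_\omega(n))_{\omega\in\Omega(n)}\in(0,1)^{\Omega(n)}$. Assume that for every constant $k\in\mathbb N$, \[\lim_{n\to\infty}\max_{\omega\in\Omega(n)}p_\omega(n)=0\quad\text{and}\quad\limsup_{n\to\infty}\Lambda_k(\Gamma(n),\mathbf p(n))<\infty.\] Let $X(n)$ be the number of edges of $\Gamma(n)$ fully contained in $\Omega(n)_{\mathbf p(n)}$. Then for every constant $k\in\mathbb N$, as $n\to\infty$, \[\Pr[X(n)=0]=\exp\big(-\kappa_1+\kappa_2-\dots+(-1)^k\kappa_k+O(\delta_1+\Delta_{k+1})\big),\] where $\kappa_1,\dots,\kappa_k,\delta_1,\Delta_{k+1}$ are computed for $(\Gamma(n),\mathbf p(n))$ and the implicit constant in $O(\cdot)$ may depend on $k$ and on the sequence.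
   Context: For a hypergraph $\Gamma=(\Omega,\mathcal X)$ with finite vertex set $\Omega$ and edge set $\mathcal X$ (a set of subsets of $\Omega$) and $\mathbf p=(p_\omega)_{\omega\in\Omega}\in(0,1)^\Omega$, let $\Omega_{\mathbf p}$ be the random subset of $\Omega$ containing each $\omega$ independently with probability $p_\omega$. Order the edges as $\gamma_1,\dots,\gamma_N$, let $X_i$ be the indicator of the event $\gamma_i\subseteq\Omega_{\mathbf p}$, and for $V\subseteq[N]$ let $X_V=\prod_{i\in V}X_i$. The dependency graph $G_\Gamma$ has vertex set $[N]$, with $i,j$ adjacent iff $i\neq j$ and $\gamma_i\cap\gamma_j\neq\emptyset$. For $V\subseteq[N]$, $\partial(V)$ is the set of vertices not in $V$ adjacent in $G_\Gamma$ to some vertex of $V$. Let $\lambda(V)=\sum_{i\in\partial(V)}\mathbb E[X_i\mid X_V=1]$ and $\Lambda_k(\Gamma,\mathbf p)=\max\{\lambda(V):V\subseteq[N],\,1\le|V|\le k\}$. Let $\mathcal C_k$ be the family of $k$-element sets $V\subseteq[N]$ with $G_\Gamma[V]$ connected. For nonempty $V$, the joint cumulant is $\kappa(V)=\sum_{\pi}(-1)^{|\pi|-1}(|\pi|-1)!\prod_{P\in\pi}\mathbb E[X_P]$, the sum over all partitions $\pi$ of $V$ into nonempty parts. Define $\kappa_k=\sum_{V\in\mathcal C_k}\kappa(V)$, $\Delta_k=\sum_{V\in\mathcal C_k}\mathbb E[X_V]$, and $\delta_k=\sum_{V\in\mathcal C_k}\mathbb E[X_V]\max_{i\in V}\mathbb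 E[X_i]$ (so $\delta_1=\sum_i\mathbb E[X_i]^2$).
   Formalization: All edges of the hypergraphs Γ(n) are assumed nonempty; if the empty set is an edge then Pr[X(n)=0]=0, which is not the exponential of a real number, so the claim would fail. *)

(* Defs.v *)
From HB Require Import structures.
From mathcomp Require Import all_boot all_order all_algebra.

Set Implicit Arguments.
Unset Strict Implicit.
Unset Printing Implicit Defensive.

Import Order.TTheory GRing.Theory Num.Theory.
Local Open Scope ring_scope.

Section Hypergraph.
Context {R : realFieldType} {Omega : finType}.
Variables (X : {set {set Omega}}) (p : Omega -> R).

(* Law of the binomial random subset: weight S is the probability that the
   random subset equals S. *)
Definition weight (S : {set Omega}) : R :=
  (\prod_(w in S) p w) * \prod_(w in ~: S) (1 - p w).

Definition Pr (A : pred {set Omega}) : R := \sum_(S | A S) weight S.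

Definition Ex (Y : {set Omega} -> R) : R := \sum_S weight S * Y S.

Definition condEx (Y : {set Omega} -> R) (A : pred {set Omega}) : R :=
  (\sum_(S | A S) weight S * Y S) / Pr A.

Local Notation N := #|X|.

Definition edge (i : 'I_N) : {set Omega} := enum_val i.

Definition ind (i : 'I_N) (S : {set Omega}) : R := (edge i \subset S)%:R.

Definition indV (V : {set 'I_N}) (S : {set Omega}) : R := \prod_(i in V) ind i S.

Definition num_edges_in (S : {set Omega}) : nat := #|[set g in X | g \subset S]|.

Definition dep (i j : 'I_N) : bool := (i != j) && (edge i :&: edge j != set0).

Definition boundary (V : {set 'I_N}) : {set 'I_N} :=
  [set i | (i \notin V) && [exists j in V, dep i j]].

Definition induced_connected (V : {set 'I_N}) : bool :=
  (V != set0) &&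
  [forall i in V, forall j in V,
     connect [rel a b | [&& a \in V, b \in V & dep a b]] i j].

Definition conn_sets (k : nat) : {set {set 'I_N}} :=
  [set V : {set 'I_N} | (#|V| == k) && induced_connected V].

Definition lambda (V : {set 'I_N}) : R :=
  \sum_(i in boundary V) condEx (ind i) (fun S => indV V S == 1).

(* The maxima below are of nonnegative quantities when p takes values in ]0, 1[,
   so the unit 0 only matters for the empty maximum. *)
Definition Lambda (k : nat) : R :=
  \big[Num.max/0]_(V : {set 'I_N} | (1 <= #|V| <= k)%N) lambda V.

Definition max_prob : R := \big[Num.max/0]_w p w.

Definition cumulant (V : {set 'I_N}) : R :=
  \sum_(pi : {set {set 'I_N}} | partition pi V)
    (-1) ^+ (#|pi|.-1) * ((#|pi|.-1)`!)%:R * \prod_(P in pi) Ex (indV P).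

Definition kappa (k : nat) : R := \sum_(V in conn_sets k) cumulant V.

Definition Delta (k : nat) : R := \sum_(V in conn_sets k) Ex (indV V).

Definition delta (k : nat) : R :=
  \sum_(V in conn_sets k) Ex (indV V) * \big[Num.max/0]_(i in V) Ex (ind i).

End Hypergraph.

(* Main.v *)
(* Write [m V = E[X_V]] and [Z I = Pr(X_i = 0 for all i in I)].  Adding an edge
   [j] multiplies [Z] by [1 - r] with [r = E[X_j prod_I (1 - X_i)] / Z I], and
   [r <= E[X_j]] by Harris' inequality, so [ln Z] changes by [- r + O(E[X_j]^2)].

   With respect to subset convolution let [n] be the inverse of [m] and
   [rho V = m(V :|: _) * n].  Then [rho [set j] A] is the joint cumulant of
   [j |: A], it vanishes unless [j |: A] is connected, and formally
   [E[X_V prod_I (1 - X_i)] = \sum_A (-1)^|A| rho V A Z(I :\: A)].  The error of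
   truncating this sum at [|A| < r] obeys a recursion obtained by removing from
   [I] the neighbours of [V] one at a time; by induction on [r] it is
   [O(Z I \sum m(V :|: W))] over the [W] of size [r] with [V :|: W] connected.
   For [V = [set j]] and [r = k] these errors add up to [O(Delta_(k+1))].

   Finally [Z(I :\: A) / Z I = 1 + O(\sum_(a in A) E[X_a])], and growing connected
   sets from a root one vertex at a time, each step costing a factor [Lambda],
   bounds the resulting error by [O(delta_1)]. *)
Require Import Defs.
From HB Require Import structures.
From mathcomp Require Import all_boot all_order all_algebra.
From mathcomp Require Import ring lra.

Set Implicit Arguments.
Unset Strict Implicit.
Unset Printing Implicit Defensive.

Import Order.TTheory GRing.Theory Num.Theory.
Local Open Scope ring_scope.

(** * Subset convolution *)

Section SubsetSums.
Variables (T : finType).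
Implicit Types (A B C D I U V W : {set T}) (j : T).

Lemma subset_setU1_notin (j : T) I U :
  j \notin I -> (U \subset j |: I) && (j \notin U) = (U \subset I).
Proof.
move=> jI; apply/andP/idP => [[/subsetP UI jU]|UI].
  apply/subsetP => x xU; have := UI x xU; rewrite !inE => /orP[/eqP xj|//].
  by rewrite -xj xU in jU.
split; first exact: subset_trans UI (subsetUr _ _).
by apply: contraNN jI => /(subsetP UI).
Qed.

Lemma big_subsetU1 (M : nmodType) (P : pred {set T}) (F : {set T} -> M) j I :
  j \notin I ->
  \sum_(U : {set T} | (U \subset j |: I) && P U) F U =
  \sum_(U : {set T} | (U \subset I) && P U) F U
  + \sum_(U : {set T} | (U \subset I) && P (j |: U)) F (j |: U).
Proof.
move=> jI; rewrite (bigID (fun U => j \in U)) /= addrC; congr (_ + _).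
  by apply: eq_bigl => U; rewrite andbAC subset_setU1_notin.
rewrite (reindex_onto (fun U => j |: U) (fun U => U :\ j)) /=.
  apply: eq_bigl => U; rewrite setU11 andbT andbAC; congr (_ && _).
  case jU : (j \in U).
    have /negbTE -> : ~~ (U \subset I) by apply: contraNN jI => /subsetP/(_ _ jU).
    apply/negbTE/negP => /andP[_ /eqP e].
    by move: jU; rewrite -e !inE eqxx.
  rewrite setU1K ?jU // eqxx andbT -(subset_setU1_notin U jI) jU andbT.
  by rewrite subUset sub1set setU11.
by move=> U /andP[_ jU]; rewrite setD1K.
Qed.

Lemma sum_subsetU1 (M : nmodType) (F : {set T} -> M) j I : j \notin I ->
  \sum_(U : {set T} | U \subset j |: I) F U =
  \sum_(U : {set T} | U \subset I) F U + \sum_(U : {set T} | U \subset I) F (j |: U).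
Proof.
move=> jI; have := big_subsetU1 predT F jI.
under eq_bigl => U do rewrite andbT.
under [X in _ = X + _]eq_bigl => U do rewrite andbT.
by under [X in _ = _ + X]eq_bigl => U do rewrite andbT.
Qed.

(** Both sides run over the ordered pairs of disjoint subsets of [I]; the left one groups them by
    their union. *)
Lemma sum_subset_pairs (M : nmodType) (G : {set T} -> {set T} -> M) I :
  \sum_(B : {set T} | B \subset I) \sum_(A : {set T} | A \subset B) G A (B :\: A) =
  \sum_(A : {set T} | A \subset I) \sum_(D : {set T} | D \subset I :\: A) G A D.
Proof.
rewrite (exchange_big_dep (fun A => A \subset I)) /=; last first.
  by move=> B A BI AB; apply: subset_trans AB BI.
apply: eq_bigr => A AI.
rewrite (reindex_onto (fun D => A :|: D) (fun B => B :\: A)) /=.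
  apply: eq_big => D.
    rewrite subsetUl andbT subUset AI /= subsetD; congr (_ && _).
    rewrite setDUl setDv set0U; apply/eqP/idP => [<-|]; last by move/setDidPl.
    by rewrite -setI_eq0 setIDAC -setIDA setDv setI0 eqxx.
  by move=> /andP[_ /eqP ->].
by move=> B /andP[_ AB]; rewrite -{2}(setID B A) (setIidPr AB).
Qed.

Lemma sum_subsetC (M : nmodType) (G : {set T} -> {set T} -> M) I :
  \sum_(A : {set T} | A \subset I) G A (I :\: A) =
  \sum_(A : {set T} | A \subset I) G (I :\: A) A.
Proof.
rewrite (reindex_onto (fun A => I :\: A) (fun A => I :\: A)) /=.
  apply: eq_big => A; last by move=> /andP[_ /eqP e]; rewrite e.
  rewrite subsetDl /= setDDr setDv set0U.
  by apply/eqP/idP => [<-|/setIidPr //]; rewrite subsetIl.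
by move=> A AI; rewrite setDDr setDv set0U; apply/setIidPr.
Qed.

Lemma setU1_ind (P : {set T} -> Prop) :
  P set0 -> (forall j I, j \notin I -> P I -> P (j |: I)) -> forall I, P I.
Proof.
move=> P0 PS I; have [n] := ubnP #|I|; elim: n I => // n IHn I ltn.
have [->//|/set0Pn[j jI]] := eqVneq I set0.
rewrite -(setD1K jI); apply: PS; first by rewrite !inE eqxx.
by apply: IHn; move: ltn; rewrite (cardsD1 j I) jI.
Qed.

End SubsetSums.

Section Convolution.
Variables (T : finType) (R : comPzRingType).
Implicit Types (A B C D I U V W : {set T}) (F G H : {set T} -> R).

(** Set functions stand for multilinear generating functions, with one variable per element and all
    squares of variables zero; this is their product. *)
Definition conv F G U : R := \sum_(A : {set T} | A \subset U) F A * G (U :\: A).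

Definition conv1 U : R := (U == set0)%:R.

Lemma eq_conv F F' G G' U :
    (forall A, A \subset U -> F A = F' A) ->
    (forall A, A \subset U -> G A = G' A) ->
  conv F G U = conv F' G' U.
Proof.
move=> eF eG; apply: eq_bigr => A AU; rewrite eF // eG //.
exact: subsetDl.
Qed.

Lemma convC F G U : conv F G U = conv G F U.
Proof.
rewrite /conv (sum_subsetC (fun A B => F A * G B)).
by apply: eq_bigr => A _; rewrite mulrC.
Qed.

Lemma convA F G H U : conv (conv F G) H U = conv F (conv G H) U.
Proof.
rewrite /conv.
under eq_bigr => A AU do rewrite big_distrl /=.
under [RHS]eq_bigr => A AU do rewrite big_distrr /=.
have := sum_subset_pairs (fun A B => F A * (G B * H (U :\: A :\: B))) U.
move=> <-; apply: eq_bigr => B BU; apply: eq_bigr => A AB.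
rewrite -mulrA setDDl; congr (_ * (_ * H (_ :\: _))).
by rewrite -{1}(setID B A) (setIidPr AB).
Qed.

Lemma conv_1l F U : conv conv1 F U = F U.
Proof.
rewrite /conv (bigD1 set0) ?sub0set //= /conv1 eqxx mul1r setD0 big1 ?addr0 //.
by move=> A /andP[_ /negbTE ->]; rewrite mul0r.
Qed.

Lemma conv_1r F U : conv F conv1 U = F U.
Proof. by rewrite convC conv_1l. Qed.

(** Passing from [F] to [F (j |: _)] is differentiation in the variable [j], so this is the Leibniz
    rule. *)
Lemma conv_setU1 F G j U : j \notin U ->
  conv F G (j |: U) =
  conv F (fun A => G (j |: A)) U + conv (fun A => F (j |: A)) G U.
Proof.
move=> jU; rewrite /conv (sum_subsetU1 _ jU); congr (_ + _); apply: eq_bigr => A AU.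
  congr (_ * G _); apply/setP => x; rewrite !inE.
  have [->/=|//] := eqVneq x j; rewrite andbT.
  by apply: contraNN jU => /(subsetP AU).
congr (_ * G _); apply/setP => x; rewrite !inE.
by have [->/=|//] := eqVneq x j; rewrite (negbTE jU) andbF.
Qed.

End Convolution.

(** * Connected vertex sets *)

Section Connectivity.
Variables (T : finType) (e : rel T).
Hypothesis e_sym : symmetric e.
Implicit Types (A B P Q U V W : {set T}).

(** Has the body of [induced_connected] over an arbitrary relation, so the two are convertible once
    [e] is [dep]; likewise [neighbours] and [boundary]. *)
Definition connected_set V : bool :=
  (V != set0) &&
  [forall i in V, forall j in V,
     connect [rel a b | [&& a \in V, b \in V & e a b]] i j].

Definition neighbours V : {set T} :=
  [set i | (i \notin V) && [exists j in V, e i j]].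

(** Connectivity by cuts instead of paths. A path from inside [P] to outside must cross the cut;
    conversely, no edge leaves the set of vertices reachable from [i]. *)
Lemma connected_setP V :
  reflect (V != set0 /\ forall P, P \subset V -> P != set0 -> P != V ->
             exists x y, [/\ x \in P, y \in V :\: P & e x y])
          (connected_set V).
Proof.
apply: (iffP andP) => -[V0 cV]; split=> //.
  move=> P PV /set0Pn[x xP] PneV.
  have [y] : exists y, y \in V :\: P.
    by apply/set0Pn; rewrite setD_eq0; apply: contraNN PneV => VP; rewrite eqEsubset PV.
  rewrite inE => /andP[yP yV].
  case: (boolP [exists u in P, exists v in V :\: P, e u v]) => [/exists_inP[u uP]|].
    by move=> /exists_inP[v vP uv]; exists u, v.
  move=> noe; exfalso.
  have /connectP[s] : connect [rel a b | [&& a \in V, b \in V & e a b]] x y.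
    by move/forall_inP/(_ _ (subsetP PV _ xP))/forall_inP: cV; apply.
  elim: s x xP => [|z s IHs] x xP /=; first by move=> _ ey; rewrite ey xP in yP.
  move=> /andP[/and3P[_ zV exz]]; apply: IHs.
  apply: contraNT noe => zP; apply/exists_inP; exists x => //.
  by apply/exists_inP; exists z; rewrite // inE zP.
apply/forall_inP => i iV; apply/forall_inP => j jV.
set r := [rel a b | _].
pose P := [set z in V | connect r i z].
have [PV|PneV] := eqVneq P V.
  by move: jV; rewrite -PV inE => /andP[].
have [] := cV P _ _ PneV.
- by apply/subsetP => z; rewrite inE => /andP[].
- by apply/set0Pn; exists i; rewrite inE iV connect0.
move=> x [y []]; rewrite !inE => /andP[xV cx] /andP[+ yV] xy.
rewrite yV /=; case/negP; apply: connect_trans cx _.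
by apply: connect1; rewrite /= xV yV.
Qed.

Lemma connected_set1 i : connected_set [set i].
Proof.
apply/connected_setP; split; first by apply/set0Pn; exists i; rewrite inE.
move=> P; rewrite subset1 => /orP[/eqP -> _|/eqP ->]; by rewrite eqxx.
Qed.

Lemma connected_set_cut U P V : V \subset U -> connected_set V ->
    (forall x y, x \in P -> y \in U :\: P -> ~~ e x y) ->
  V \subset P \/ [disjoint V & P].
Proof.
move=> VU /connected_setP[V0 cV] noe.
case: (boolP [disjoint V & P]) => [|VP]; [by right|left].
have [VPV|VPneV] := eqVneq (V :&: P) V; first by apply/setIidPl.
have [||x [y [xP yP exy]]] := cV (V :&: P) _ _ VPneV; first exact: subsetIl.
  by rewrite setI_eq0.
move: xP yP; rewrite !inE => /andP[xV xP] /andP[+ yV]; rewrite yV /= => yP.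
by have := noe x y xP; rewrite !inE yP (subsetP VU _ yV) exy => /(_ isT).
Qed.

Lemma connected_setU V W x y : connected_set V -> connected_set W ->
  x \in V -> y \in W -> e x y -> connected_set (V :|: W).
Proof.
move=> cV cW xV yW exy.
apply/connected_setP; split.
  by apply/set0Pn; exists x; rewrite inE xV.
move=> P PVW P0 PneVW.
case: (boolP [exists u in P, exists v in (V :|: W) :\: P, e u v]).
  by move=> /exists_inP[u uP] /exists_inP[v vP uv]; exists u, v.
move=> noe; exfalso.
have cut u v : u \in P -> v \in (V :|: W) :\: P -> ~~ e u v.
  move=> uP vP; apply: contraNN noe => uv; apply/exists_inP; exists u => //.
  by apply/exists_inP; exists v.
have [VP|VP] := connected_set_cut (subsetUl V W) cV cut;
have [WP|WP] := connected_set_cut (subsetUr V W) cW cut.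
- by case/negP: PneVW; rewrite eqEsubset PVW subUset VP.
- have := cut x y (subsetP VP _ xV).
  by rewrite !inE yW orbT andbT (disjointFr WP yW) exy => /(_ isT).
- have := cut y x (subsetP WP _ yW).
  by rewrite !inE xV andbT (disjointFr VP xV) e_sym exy => /(_ isT).
- case/set0Pn: P0 => z zP; have := subsetP PVW _ zP; rewrite inE.
  by rewrite (disjointFl VP zP) (disjointFl WP zP).
Qed.

Lemma connected_setU1 V j :
  connected_set V -> j \in neighbours V -> connected_set (j |: V).
Proof.
move=> cV; rewrite inE => /andP[_ /exists_inP[i iV ji]].
by apply: connected_setU (connected_set1 j) cV _ iV ji; rewrite inE.
Qed.

Lemma connected_set_neighbour V U : V != set0 -> V \proper U ->
  connected_set U -> exists2 j, j \in U & j \in neighbours V.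
Proof.
move=> V0 /properP[VU [z zU zV]] /connected_setP[_ cU].
have [|x [y [xV]]] := cU V VU V0; first by apply: contraNneq zV => ->.
rewrite inE => /andP[yV yU] exy; exists y => //.
by rewrite inE yV /=; apply/exists_inP; exists x; rewrite // e_sym.
Qed.

Lemma disconnected_split U V : connected_set V -> V \subset U ->
  ~~ connected_set U ->
  exists P Q, [/\ V \subset P, Q != set0, P :|: Q = U, [disjoint P & Q] &
                  forall x y, x \in P -> y \in Q -> ~~ e x y].
Proof.
move=> cV VU ncU.
have V0 : V != set0 by case/andP: cV.
have U0 : U != set0.
  by case/set0Pn: V0 => v vV; apply/set0Pn; exists v; apply: (subsetP VU).
case: (boolP [exists P : {set T}, [&& P \subset U, P != set0, P != U &
   [forall x in P, forall y in U :\: P, ~~ e x y]]]); last first.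
  rewrite negb_exists => /forallP noc; case/negP: ncU; apply/connected_setP.
  split=> // P PU P0 PneU; have := noc P; rewrite PU P0 PneU /=.
  rewrite negb_forall_in => /exists_inP[x xP].
  rewrite negb_forall_in => /exists_inP[y yP]; rewrite negbK => xy.
  by exists x, y.
move=> /existsP[P /and4P[PU P0 PneU /forall_inP noe]].
have cut x y : x \in P -> y \in U :\: P -> ~~ e x y.
  by move=> xP; move: (noe x xP) => /forall_inP; apply.
have UP0 : U :\: P != set0.
  by rewrite setD_eq0; apply: contraNN PneU; rewrite eqEsubset PU.
have PUP : P :|: (U :\: P) = U.
  by rewrite -{2}(setID U P) (setIidPr PU).
have dPUP : [disjoint P & U :\: P].
  by rewrite -setI_eq0 setIDA setDIl setDv set0I.
have [VP|VP] := connected_set_cut VU cV cut; first by exists P, (U :\: P).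
(* Here [V] lies on the other side of the cut, so the two sides are exchanged. *)
exists (U :\: P), P; split=> //.
- by rewrite subsetD VU.
- by rewrite setUC.
- by rewrite disjoint_sym.
- by move=> x y xP yP; rewrite e_sym; apply: cut.
Qed.

(* Take a maximal proper connected subset containing [a]; the edge leaving it
   must complete [U]. *)
Lemma connected_set_pred U a : connected_set U -> a \in U -> (1 < #|U|)%N ->
  exists V j, [/\ connected_set V, a \in V, j \in neighbours V & U = j |: V].
Proof.
move=> cU aU U1.
pose good V := [&& connected_set V, a \in V & V \proper U].
have g1 : good [set a].
  rewrite /good connected_set1 inE eqxx /= properEcard sub1set aU.
  by rewrite cards1.
have [V /maxsetP[gV maxV] _] := @maxset_exists _ good [set a] g1.
case/and3P: gV => cV aV pV.
have V0 : V != set0 by case/andP: cV.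
have [j jU jV] := connected_set_neighbour V0 pV cU.
exists V, j; split=> //.
have jVU : j |: V \subset U by rewrite subUset sub1set jU proper_sub.
apply/eqP; rewrite eq_sym eqEsubset jVU /=; apply/negPn/negP => njVU.
have jVV : j |: V = V.
  apply: maxV; last exact: subsetUr.
  by rewrite /good connected_setU1 // inE aV orbT /= properE jVU.
by move: jV; rewrite inE -{1}jVV setU11.
Qed.

End Connectivity.

(** * Joint cumulants *)

Section Cumulants.
Variables (T : finType) (R : comPzRingType) (m : {set T} -> R).
Hypothesis m0 : m set0 = 1.
Implicit Types (A B P U V : {set T}) (pi : {set {set T}}).

(** The factorial counts the orderings of the blocks, so this is the Neumann series of the inverse
    of [m] under [conv]: the sum over s of (-1)^s times the s-th power of [m] minus the unit. *)
Definition moment_inv U : R :=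
  \sum_(pi | partition pi U) (-1) ^+ #|pi| * (#|pi|`!)%:R * \prod_(P in pi) m P.

Definition joint_cumulant V : R :=
  \sum_(pi | partition pi V)
    (-1) ^+ (#|pi|.-1) * ((#|pi|.-1)`!)%:R * \prod_(P in pi) m P.

(** Double counting of partitions with a marked block: once the block [P] is removed, what remains
    is any partition of [U :\: P]. *)
Lemma big_partition_block (M : nmodType) (Q : pred {set T})
    (F : {set T} -> {set {set T}} -> M) U :
  \sum_(pi | partition pi U) \sum_(P in pi | Q P) F P (pi :\ P) =
  \sum_(P : {set T} | (P \subset U) && ((P != set0) && Q P))
    \sum_(pi | partition pi (U :\: P)) F P pi.
Proof.
rewrite (exchange_big_dep
  (fun P : {set T} => (P \subset U) && ((P != set0) && Q P))) /=; last first.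
  move=> pi P piU /andP[Ppi ->]; rewrite andbT.
  by rewrite (partitionS piU Ppi) (partition_neq0 piU Ppi).
apply: eq_bigr => P /and3P[PU P0 QP].
rewrite (reindex_onto (fun pi => P |: pi) (fun pi => pi :\ P)) /=; last first.
  by move=> pi /and3P[_ Ppi _]; rewrite setD1K.
apply: eq_big => pi; last by case/andP=> _ /eqP ->.
rewrite setU11 QP !andbT; apply/andP/idP => [[piU /eqP e]|piU].
  by rewrite -e; apply: partitionD1; rewrite ?setU11.
have Ppi : P \notin pi.
  apply: contraNN P0 => Ppi; have := partitionS piU Ppi.
  by rewrite subsetD => /andP[_]; rewrite -setI_eq0 setIid.
rewrite setU1K // eqxx; split=> //.
rewrite -{1}(setID U P) (setIidPr PU); apply: partitionU1 => //.
by rewrite -setI_eq0 setIDA setDIl setDv set0I.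
Qed.

Lemma partition_card_gt0 pi U : partition pi U -> U != set0 -> (0 < #|pi|)%N.
Proof.
move=> piU; apply: contraNT; rewrite -leqNgt leqn0 cards_eq0 => /eqP pi0.
by rewrite -(cover_partition piU) pi0 /cover big_set0.
Qed.

(** Splits off the first block of an ordered partition. Each of the [#|pi|] blocks can come first,
    and the others are then ordered in [(#|pi|.-1)!] ways. *)
Lemma moment_inv_block U : U != set0 ->
  moment_inv U =
  - \sum_(P : {set T} | (P \subset U) && (P != set0)) m P * moment_inv (U :\: P).
Proof.
move=> U0.
have := big_partition_block predT (fun P pi =>
  m P * ((-1) ^+ #|pi| * (#|pi|`!)%:R * \prod_(Q in pi) m Q)) U.
under [X in _ = X -> _]eq_bigl => P do rewrite andbT.
under [X in _ = X -> _]eq_bigr => P _ do rewrite -big_distrr /=.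
rewrite /moment_inv => <-; rewrite -sumrN; apply: eq_bigr => pi piU.
have pi_gt0 := partition_card_gt0 piU U0.
transitivity (- \sum_(P in pi)
    (-1) ^+ #|pi|.-1 * ((#|pi|.-1)`!)%:R * \prod_(Q in pi) m Q).
  rewrite sumr_const; case: #|pi| pi_gt0 => // s _ /=.
  rewrite -[in RHS](mulr_natl _ s.+1) factS natrM exprS.
  by rewrite !mulN1r !mulNr !mulrA; congr (- (_ * _ * _)); rewrite mulrC.
congr (- _); apply: eq_big => P; first by rewrite andbT.
move=> Ppi; rewrite (cardsD1 P pi) Ppi /= (bigD1 P) //=.
rewrite [X in _ = _ * (_ * X)](eq_bigl (fun Q => (Q \in pi) && (Q != P))); last first.
  by move=> Q; rewrite !inE andbC.
by rewrite mulrCA.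
Qed.

Lemma moment_inv0 : moment_inv set0 = 1.
Proof.
rewrite /moment_inv (big_pred1 set0); last by move=> pi; rewrite partition_set0.
by rewrite cards0 big_set0 fact0 expr0 !mulr1.
Qed.

Lemma conv_moment_inv U : conv m moment_inv U = conv1 R U.
Proof.
rewrite /conv /conv1 (bigD1 set0) ?sub0set //= m0 mul1r setD0.
have [->|U0] := eqVneq U set0.
  rewrite moment_inv0 big1 ?addr0 // => A /andP[].
  by rewrite subset0 => ->.
by rewrite moment_inv_block // addNr.
Qed.

(** Marking the block that contains [i] marks exactly one block per partition; the remaining
    [#|pi|.-1] blocks carry the sign and factorial of [moment_inv]. *)
Lemma joint_cumulantE i A : i \notin A ->
  joint_cumulant (i |: A) = conv (fun B => m (i |: B)) moment_inv A.
Proof.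
move=> iA; rewrite /conv.
have := big_partition_block (fun P : {set T} => i \in P) (fun P pi =>
  m P * ((-1) ^+ #|pi| * (#|pi|`!)%:R * \prod_(Q in pi) m Q)) (i |: A).
under [X in _ = X -> _]eq_bigr => P _ do rewrite -big_distrr /=.
rewrite (big_subsetU1 _ _ iA) [X in _ = X + _]big1 ?add0r; last first.
  move=> P /and3P[PA _ iP]; case/negP: iA; exact: subsetP PA _ iP.
move=> eq; transitivity (\sum_(pi | partition pi (i |: A))
    \sum_(P in pi | i \in P)
     m P * ((-1) ^+ #|pi :\ P| * (#|pi :\ P|`!)%:R * \prod_(Q in pi :\ P) m Q)).
  apply: eq_bigr => pi piU.
  have iU : i \in i |: A by rewrite setU11.
  have covi : i \in cover pi by rewrite (cover_partition piU).
  rewrite [RHS](big_pred1 (pblock pi i)); last first.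
    move=> P /=; apply/andP/eqP => [[Ppi iP]|->].
      by rewrite (def_pblock (partition_trivIset piU) Ppi iP).
    by rewrite pblock_mem // mem_pblock.
  set P := pblock pi i; have Ppi : P \in pi by apply: pblock_mem.
  rewrite (cardsD1 P pi) Ppi /= (bigD1 P) //=.
  rewrite [X in _ = _ * (_ * X)](eq_bigl (fun Q => (Q \in pi) && (Q != P))); last first.
    by move=> Q; rewrite !inE andbC.
  by rewrite mulrCA.
rewrite eq; apply: eq_big => P.
  rewrite setU11 andbT; case: (P \subset A) => //=.
  by apply/set0Pn; exists i; rewrite setU11.
move=> /andP[PA _]; congr (_ * _); congr moment_inv.
apply/setP => x; rewrite !inE.
by have [->|//] := eqVneq x i; rewrite (negbTE iA) andbF.
Qed.

End Cumulants.

(** * Convolution over a disjoint union *)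

Section SplitSums.
Variables (T : finType).
Implicit Types (A B C D P Q U V : {set T}).

Lemma big_subsetU (M : nmodType) (h : {set T} -> M) C D : [disjoint C & D] ->
  \sum_(U : {set T} | U \subset C :|: D) h U =
  \sum_(A : {set T} | A \subset C) \sum_(B : {set T} | B \subset D) h (A :|: B).
Proof.
elim/setU1_ind: C h => [|j C jC IH] h dCD.
  rewrite set0U [RHS](big_pred1 set0); last by move=> A; rewrite subset0.
  by apply: eq_bigr => B _; rewrite set0U.
have [jD dCD'] : j \notin D /\ [disjoint C & D].
  by move: dCD; rewrite -setI_eq0 setIUl setU_eq0 !setI_eq0 disjoints1 => /andP[].
have jCD : j \notin C :|: D by rewrite inE negb_or jC.
rewrite -setUA !sum_subsetU1 // IH // (IH (fun U => h (j |: U))) //; congr (_ + _).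
by apply: eq_bigr => A _; apply: eq_bigr => B _; rewrite setUA.
Qed.

Lemma conv_split (R : comPzRingType) (F F1 F2 G G1 G2 : {set T} -> R) C D :
    [disjoint C & D] ->
    (forall A B, A \subset C -> B \subset D -> F (A :|: B) = F1 A * F2 B) ->
    (forall A B, A \subset C -> B \subset D -> G (A :|: B) = G1 A * G2 B) ->
  conv F G (C :|: D) = conv F1 G1 C * conv F2 G2 D.
Proof.
move=> dCD hF hG; rewrite /conv (big_subsetU _ dCD) big_distrl /=.
apply: eq_bigr => A AC; rewrite big_distrr /=; apply: eq_bigr => B BD.
have -> : (C :|: D) :\: (A :|: B) = (C :\: A) :|: (D :\: B).
  apply/setP => x; rewrite !inE; case xC : (x \in C) => /=.
    have xD := disjointFr dCD xC; rewrite xD !(andbF, orbF, andbT).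
    have /negbTE -> : x \notin B by apply: contraFN xD; apply: (subsetP BD).
    by rewrite orbF.
  have /negbTE -> : x \notin A by apply: contraFN xC; apply: (subsetP AC).
  by rewrite ?andbF.
rewrite hF // hG ?subsetDl //; ring.
Qed.

End SplitSums.

(** * Relative cumulants: quotient rule, vanishing, size *)

Section ClusterExpansion.
Variables (T : finType) (R : realFieldType) (m : {set T} -> R) (e : rel T).
Hypotheses (e_sym : symmetric e) (m0 : m set0 = 1) (m_ge0 : forall A, 0 <= m A).
Hypothesis m_sup : forall A B, m A * m B <= m (A :|: B).
Hypothesis m_indep : forall A B : {set T}, [disjoint A & B] ->
  (forall a b, a \in A -> b \in B -> ~~ e a b) -> m (A :|: B) = m A * m B.
Implicit Types (A B C D I J P Q U V W : {set T}).

Local Notation n := (moment_inv m).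

Definition rel_cumulant V := conv (fun A => m (V :|: A)) n.
Local Notation rho := rel_cumulant.

Lemma rel_cumulant0 V : rho V set0 = m V.
Proof.
rewrite /rho /conv (big_pred1 set0); last by move=> A; rewrite subset0.
by rewrite setU0 setD0 moment_inv0 mulr1.
Qed.

(** [rho V] is the quotient of [m (V :|: _)] by [m]; this is the quotient rule for its derivative in
    the variable [j]. *)
Lemma rel_cumulant_setU1 V j B : j \notin B ->
  rho V (j |: B) = rho (j |: V) B - conv (rho V) (rho [set j]) B.
Proof.
move=> jB; rewrite {1}/rho conv_setU1 // addrC; congr (_ + _).
  by apply: eq_bigr => A _; rewrite setUCA setUA.
have convN F G U : conv F (fun A => - G A) U = - conv F G U :> R.
  by rewrite /conv -sumrN; apply: eq_bigr => A _; rewrite mulrN.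
(* Differentiating the identity that [m] times [n] is the unit shows that [m] times the derivative
   of [n] is [- rho [set j]]; multiplying by [n] isolates the derivative. *)
have Dn A : A \subset B -> n (j |: A) = conv n (fun C => - rho [set j] C) A.
  move=> AB.
  rewrite -[LHS](conv_1l (fun C => n (j |: C))).
  transitivity (conv (conv n m) (fun C => n (j |: C)) A).
    by apply: eq_conv => // C _; rewrite convC conv_moment_inv.
  rewrite convA; apply: eq_conv => // C CA.
  have jC : j \notin C.
    by apply: contraNN jB; apply/subsetP; apply: subset_trans CA AB.
  have jC0 : j |: C != set0 by apply/set0Pn; exists j; rewrite setU11.
  have := conv_moment_inv m0 (j |: C).
  rewrite conv_setU1 // /conv1 (negbTE jC0).
  by move/eqP; rewrite addr_eq0 => /eqP.
rewrite (eq_conv (F' := fun A => m (V :|: A)) (G' := conv n (fun C => - rho [set j] C))) //.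
by rewrite -convA convN.
Qed.

(* Convolution inverses are unique, and the right-hand side is another one. *)
Lemma moment_invU P Q A B : [disjoint P & Q] ->
    (forall x y, x \in P -> y \in Q -> ~~ e x y) ->
  A \subset P -> B \subset Q -> n (A :|: B) = n A * n B.
Proof.
move=> dPQ noe AP BQ.
pose n' U := n (U :&: P) * n (U :&: Q).
have IP C D : C \subset P -> D \subset Q -> (C :|: D) :&: P = C.
  move=> CP DQ; rewrite setIUl (setIidPl CP).
  have /eqP -> : D :&: P == set0.
    by rewrite setI_eq0; apply: disjointWl DQ _; rewrite disjoint_sym.
  by rewrite setU0.
have IQ C D : C \subset P -> D \subset Q -> (C :|: D) :&: Q = D.
  move=> CP DQ; rewrite setIUl (setIidPl DQ).
  have /eqP -> : C :&: Q == set0 by rewrite setI_eq0; apply: disjointWl CP _.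
  by rewrite set0U.
have n'E C D : C \subset P -> D \subset Q -> n' (C :|: D) = n C * n D.
  by move=> CP DQ; rewrite /n' IP ?IQ.
have mn' U : U \subset A :|: B -> conv m n' U = conv1 R U.
  move=> UAB; have -> : U = (U :&: A) :|: (U :&: B) by rewrite -setIUr; apply/esym/setIidPl.
  set C := U :&: A; set D := U :&: B.
  have CP : C \subset P by apply: subset_trans AP; apply: subsetIr.
  have DQ : D \subset Q by apply: subset_trans BQ; apply: subsetIr.
  rewrite (conv_split (F1 := m) (F2 := m) (G1 := n) (G2 := n)).
  - rewrite !conv_moment_inv // /conv1 setU_eq0.
    by case: (C == set0); rewrite ?mul1r ?mul0r.
  - by apply: disjointWl CP _; apply: disjointWr DQ _.
  - move=> C' D' CC' DD'; apply: m_indep.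
      apply: disjointWl (subset_trans CC' CP) _.
      by apply: disjointWr (subset_trans DD' DQ) _.
    move=> x y xC yD; apply: noe.
      exact: subsetP (subset_trans CC' CP) _ xC.
    exact: subsetP (subset_trans DD' DQ) _ yD.
  - move=> C' D' CC' DD'; apply: n'E; first exact: subset_trans CC' CP.
    exact: subset_trans DD' DQ.
rewrite -n'E // -[RHS](conv_1l n').
transitivity (conv (conv n m) n' (A :|: B)).
  rewrite convA -[LHS]conv_1r; apply: eq_conv => // C CU.
  by rewrite mn'.
by apply: eq_conv => // C _; rewrite convC conv_moment_inv.
Qed.

(** Split [V :|: B] into [P], containing [V], and a nonempty [Q] without edges between them. By
    independence the convolution factors, and its factor over [Q] is [conv m n Q], which
    vanishes. *)
Lemma rel_cumulant_eq0 V B :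
  connected_set e V -> ~~ connected_set e (V :|: B) -> rho V B = 0.
Proof.
move=> cV ncU.
have [P [Q [VP Q0 PQ dPQ noe]]] := disconnected_split e_sym cV (subsetUl V B) ncU.
have QB : Q \subset B.
  apply/subsetP => x xQ.
  have : x \in V :|: B by rewrite -PQ inE xQ orbT.
  rewrite inE => /orP[xV|//].
  by have := disjointFl dPQ xQ; rewrite (subsetP VP).
have BE : B = (B :&: P) :|: Q.
  apply/setP => x; rewrite !inE.
  case xB : (x \in B) => /=; last first.
    by apply/esym/negbTE; apply: contraFN xB; apply: (subsetP QB).
  by have : x \in P :|: Q by [rewrite PQ inE xB orbT]; rewrite inE => ->.
rewrite BE /rho.
rewrite (conv_split (F1 := fun A => m (V :|: A)) (F2 := m) (G1 := n) (G2 := n)).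
- by rewrite conv_moment_inv // /conv1 (negbTE Q0) mulr0.
- by apply: disjointWl dPQ; apply: subsetIr.
- move=> C D CP DQ; rewrite setUA.
  have VCP : V :|: C \subset P by rewrite subUset VP (subset_trans CP (subsetIr _ _)).
  apply: m_indep; first by apply: disjointWl VCP _; apply: disjointWr DQ _.
  by move=> x y xC yD; apply: noe; [apply: subsetP VCP _ xC|apply: subsetP DQ _ yD].
- move=> C D CP DQ; apply: (moment_invU dPQ noe) => //.
  by apply: subset_trans CP (subsetIr _ _).
Qed.

(* A family of subsets of a [k]-set is one of [2 ^ (2 ^ k)]. *)
Definition inv_const k : R := ((2 ^ (2 ^ k)) * k`!)%:R.
Definition cumulant_const k : R := (2 ^ k)%:R * inv_const k.

Lemma cumulant_const_ge0 k : 0 <= cumulant_const k.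
Proof. by rewrite mulr_ge0 ?ler0n. Qed.

Lemma prod_partition_le pi U : partition pi U -> \prod_(P in pi) m P <= m U.
Proof.
move=> /cover_partition <-; rewrite /cover.
suff : 0 <= \prod_(P in pi) m P <= m (\bigcup_(P in pi) P) by case/andP.
apply: (big_rec2 (fun (x : R) (A : {set T}) => 0 <= x <= m A)); first by rewrite m0 ler01 lexx.
move=> P A x _ /andP[x0 xA]; rewrite mulr_ge0 //=.
by apply: le_trans (m_sup _ _); apply: ler_wpM2l.
Qed.

Lemma card_partition_le pi U : partition pi U -> (#|pi| <= #|U|)%N.
Proof.
move=> piU; rewrite (card_partition piU) -sum1_card; apply: leq_sum => P Ppi.
by rewrite card_gt0 (partition_neq0 piU Ppi).
Qed.

Lemma moment_inv_le U k : (#|U| <= k)%N -> `|n U| <= inv_const k * m U.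
Proof.
move=> Uk; apply: le_trans (ler_norm_sum _ _ _) _.
have bound pi : partition pi U ->
    `|(-1) ^+ #|pi| * (#|pi|`!)%:R * \prod_(P in pi) m P| <= (k`!)%:R * m U.
  move=> piU; rewrite !normrM normrX normrN1 expr1n mul1r normr_nat.
  rewrite ger0_norm; last by apply: prodr_ge0.
  apply: ler_pM; rewrite ?ler0n ?prodr_ge0 ?prod_partition_le //.
  rewrite ler_nat; apply: leq_fact; exact: leq_trans (card_partition_le piU) Uk.
apply: le_trans (ler_sum _ bound) _.
rewrite sumr_const -[leLHS]mulr_natl /inv_const natrM -mulrA.
apply: ler_wpM2r; first by rewrite mulr_ge0 ?ler0n.
rewrite ler_nat.
apply: (@leq_trans #|powerset (powerset U)|).
  apply: subset_leq_card; apply/subsetP => pi piU; rewrite inE.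
  by apply/subsetP => P Ppi; rewrite inE (partitionS piU Ppi).
by rewrite !card_powerset !leq_exp2l.
Qed.

(** [m_sup] bounds every term by the moment of the full union, and there are at most [2 ^ k]
    terms. *)
Lemma rel_cumulant_le V B k : (#|B| <= k)%N ->
  `|rho V B| <= cumulant_const k * m (V :|: B).
Proof.
move=> Bk; apply: le_trans (ler_norm_sum _ _ _) _.
have bound A : A \subset B ->
    `|m (V :|: A) * n (B :\: A)| <= inv_const k * m (V :|: B).
  move=> AB; rewrite normrM ger0_norm //.
  have -> : V :|: B = (V :|: A) :|: (B :\: A).
    by rewrite -setUA -{1}(setID B A) (setIidPr AB).
  apply: (@le_trans _ _ (m (V :|: A) * (inv_const k * m (B :\: A)))).
    apply: ler_wpM2l => //; apply: moment_inv_le.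
    by apply: leq_trans Bk; apply: subset_leq_card; apply: subsetDl.
  by rewrite mulrCA; apply: ler_wpM2l; rewrite ?ler0n.
apply: le_trans (ler_sum _ bound) _.
rewrite sumr_const -[leLHS]mulr_natl -mulrA.
apply: ler_wpM2r; first by rewrite mulr_ge0 ?ler0n.
rewrite ler_nat.
apply: (@leq_trans #|powerset B|); last by rewrite card_powerset leq_exp2l.
by apply: subset_leq_card; apply/subsetP => A; rewrite !inE.
Qed.

End ClusterExpansion.

(** * Truncated cluster expansion *)

Section Avoidance.
Variables (T : finType) (R : realFieldType) (m : {set T} -> R) (e : rel T).
Hypotheses (e_sym : symmetric e) (m0 : m set0 = 1) (m_ge0 : forall A, 0 <= m A).
Hypothesis m_sup : forall A B, m A * m B <= m (A :|: B).
Hypothesis m_indep : forall A B : {set T}, [disjoint A & B] ->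
  (forall a b, a \in A -> b \in B -> ~~ e a b) -> m (A :|: B) = m A * m B.
Implicit Types (A B C D I J P Q U V W : {set T}).
Local Notation rho := (rel_cumulant m).

(* [E[X_V prod_(i in I) (1 - X_i)]], expanded by inclusion-exclusion. *)
Definition avoid V I : R :=
  \sum_(U : {set T} | U \subset I) (-1) ^+ #|U| * m (V :|: U).
Local Notation Z := (avoid set0).

Hypothesis avoid_ge0 : forall V I, 0 <= avoid V I.
(** Harris' inequality in terms of moments: the presence of [V] can only lower the chance of
    avoiding [I]. *)
Hypothesis avoid_le : forall V I, avoid V I <= m V * Z I.

Lemma avoid0 V : avoid V set0 = m V.
Proof.
rewrite /avoid (big_pred1 set0); last by move=> A; rewrite subset0.
by rewrite cards0 expr0 mul1r setU0.
Qed.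

Lemma avoid_setU1 V j I :
  j \notin I -> avoid V (j |: I) = avoid V I - avoid (j |: V) I.
Proof.
move=> jI; rewrite /avoid (sum_subsetU1 _ jI).
congr (_ + _); rewrite -sumrN; apply: eq_bigr => U UI.
have jU : j \notin U by apply: contraNN jI; apply: (subsetP UI).
by rewrite cardsU1 jU exprS -mulrA mulN1r setUCA setUA.
Qed.

Lemma avoid_indep V I : [disjoint V & I] ->
  (forall x y, x \in V -> y \in I -> ~~ e x y) -> avoid V I = m V * Z I.
Proof.
move=> dVI noe; rewrite /avoid big_distrr; apply: eq_bigr => U UI.
rewrite set0U m_indep; first by rewrite mulrCA.
  exact: disjointWr UI dVI.
by move=> x y xV yU; apply: noe => //; apply: subsetP UI _ yU.
Qed.

Lemma avoidZ_setU1_ge j I : Z I * (1 - m [set j]) <= Z (j |: I).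
Proof.
have [jI|jI] := boolP (j \in I).
  rewrite (setUidPr _) ?sub1set // mulrBr mulr1 gerBl.
  by rewrite mulr_ge0.
rewrite avoid_setU1 // mulrBr mulr1 lerD2l lerN2 mulrC setU0.
exact: avoid_le.
Qed.

Lemma avoidZ_setU1_le j I : Z (j |: I) <= Z I.
Proof.
have [jI|jI] := boolP (j \in I); first by rewrite (setUidPr _) ?sub1set.
by rewrite avoid_setU1 // gerBl.
Qed.

Lemma avoidZ_setU_le I J : Z (I :|: J) <= Z I.
Proof.
elim/setU1_ind: J => [|j J jJ IH]; first by rewrite setU0.
by rewrite setUCA; apply: le_trans IH; apply: avoidZ_setU1_le.
Qed.

Lemma avoidZ_anti I J : I \subset J -> Z J <= Z I.
Proof. by move=> /setUidPr <-; apply: avoidZ_setU_le. Qed.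

Hypothesis m1_half : forall i, m [set i] <= 1 / 2.

(** Each new element costs a factor of at least [1 - m [set j]], and (1 - s)(1 - x) is at least 1 -
    s - x for nonnegative s and x. *)
Lemma avoidZ_setU_sum I J :
  Z I * (1 - \sum_(j in J) m [set j]) <= Z (I :|: J).
Proof.
elim/setU1_ind: J => [|j J jJ IH].
  by rewrite setU0 big_set0 subr0 mulr1.
rewrite setUCA big_setU1 //=; apply: le_trans (avoidZ_setU1_ge _ _).
have mj : 0 <= 1 - m [set j] by have := m1_half j; lra.
apply: le_trans (ler_wpM2r mj IH); rewrite -mulrA; apply: ler_wpM2l => //.
have s0 : 0 <= \sum_(j in J) m [set j] by apply: sumr_ge0.
have := mulr_ge0 s0 (m_ge0 [set j]); lra.
Qed.

(** By [m1_half] each added element at most halves [Z]. Started from [Z set0 = 1], this also makes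
    [Z] positive. *)
Lemma avoidZ_setU_exp I J : Z I <= 2 ^+ #|J| * Z (I :|: J).
Proof.
elim/setU1_ind: J => [|j J jJ IH].
  by rewrite setU0 cards0 expr0 mul1r.
rewrite setUCA cardsU1 jJ exprSr -mulrA; apply: le_trans IH _.
apply: ler_wpM2l; first by rewrite exprn_ge0.
have := avoidZ_setU1_ge j (I :|: J); have := avoid_ge0 set0 (I :|: J).
by have := m1_half j; nra.
Qed.

Lemma avoidZ_setD I B : Z (I :\: B) <= 2 ^+ #|B| * Z I.
Proof.
apply: le_trans (avoidZ_setU_exp _ B) _; apply: ler_wpM2l.
  by rewrite exprn_ge0.
apply: avoidZ_anti; rewrite -{1}(setID I B) setUC; apply: setUS.
exact: subsetIr.
Qed.

Lemma avoidZ_gt0 I : 0 < Z I.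
Proof.
have := avoidZ_setU_exp set0 I; rewrite set0U avoid0 m0 => h.
have := lt_le_trans ltr01 h; by rewrite pmulr_rgt0 // exprn_gt0.
Qed.

(** * Recursion for the truncation error *)

Definition remainder r V I : R :=
  avoid V I - \sum_(A : {set T} | (A \subset I) && (#|A| < r)%N)
                (-1) ^+ #|A| * rho V A * Z (I :\: A).

Lemma remainder0 V I : remainder 0 V I = avoid V I.
Proof.
by rewrite /remainder big_pred0 ?subr0 // => A; rewrite ltn0 andbF.
Qed.

Lemma setD_setU1 j I A : j \notin A -> (j |: I) :\: A = j |: (I :\: A).
Proof.
move=> jA; apply/setP => x; rewrite !inE; have [->|//] := eqVneq x j.
by rewrite jA.
Qed.

Lemma setD_setU11 j I A : j \notin I -> (j |: I) :\: (j |: A) = I :\: A.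
Proof.
move=> jI; apply/setP => x; rewrite !inE; have [->|//] := eqVneq x j.
by rewrite (negbTE jI) andbF.
Qed.

Lemma setUDid A B : A \subset B -> A :|: (B :\: A) = B.
Proof. by move=> AB; rewrite -{2}(setID B A) (setIidPr AB). Qed.

Lemma setUDid_card A B : A \subset B -> (#|A| + #|B :\: A|)%N = #|B|.
Proof. by move=> AB; rewrite -(cardsID A B) (setIidPr AB). Qed.

(** Every ingredient is differenced in [j]: [avoid] by inclusion-exclusion, [rho] by the quotient
    rule. The product term of the quotient rule is exactly what truncates the new factors [avoid
    [set j] (I :\: B)], which therefore appear as remainders of lower order. *)
Lemma remainder_rec r V j I : j \notin I ->
  remainder r.+1 V (j |: I) =
  remainder r.+1 V I - remainder r (j |: V) I
  + \sum_(B : {set T} | (B \subset I) && (#|B| <= r)%N)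
      (-1) ^+ #|B| * rho V B * remainder (r - #|B|) [set j] (I :\: B).
Proof.
move=> jI; rewrite /remainder avoid_setU1 //.
rewrite (big_subsetU1 (fun A : {set T} => (#|A| < r.+1)%N)) //=.
(* Sets [A] without [j]: the factor [Z (j |: (I :\: A))] splits into two. *)
rewrite (eq_bigr (fun A : {set T} => (-1) ^+ #|A| * rho V A * Z (I :\: A)
    - (-1) ^+ #|A| * rho V A * avoid [set j] (I :\: A))); last first.
  move=> A /andP[AI _].
  have jA : j \notin A by apply: contraNN jI; apply: (subsetP AI).
  rewrite setD_setU1 // avoid_setU1 ?mulrBr ?setU0 //.
  by rewrite inE negb_and jI orbT.
rewrite sumrB.
(* Sets [j |: B]: the extra element flips the sign and lowers the size bound to [#|B| < r], and the
   quotient rule applies. *)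
rewrite [X in _ - (_ + X)](_ : _ =
    - \sum_(B : {set T} | (B \subset I) && (#|B| < r)%N)
        (-1) ^+ #|B| * rho (j |: V) B * Z (I :\: B)
    + \sum_(B : {set T} | (B \subset I) && (#|B| < r)%N)
        (-1) ^+ #|B| * conv (rho V) (rho [set j]) B * Z (I :\: B)); last first.
  rewrite -sumrN -big_split /=; apply: eq_big => A.
    case AI : (A \subset I) => //=.
    have jA : j \notin A by apply: contraNN jI; apply: (subsetP AI).
    by rewrite cardsU1 jA.
  move=> /andP[AI _].
  have jA : j \notin A by apply: contraNN jI; apply: (subsetP AI).
  rewrite cardsU1 jA exprS rel_cumulant_setU1 // setD_setU11 //.
  by move: (_ ^+ _) (rho _ _) (conv _ _ _) (Z _) => a b c d; ring.
(* The sums inside the remainders at [[set j]] run over pairs of disjoint sets of total size below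
   [r]; grouped by union they form a convolution. *)
rewrite [X in _ = _ + X](_ : _ =
    \sum_(B : {set T} | (B \subset I) && (#|B| <= r)%N)
      (-1) ^+ #|B| * rho V B * avoid [set j] (I :\: B)
    - \sum_(B : {set T} | (B \subset I) && (#|B| < r)%N)
        (-1) ^+ #|B| * conv (rho V) (rho [set j]) B * Z (I :\: B)); last first.
  under eq_bigr => B _ do rewrite mulrBr.
  rewrite sumrB; congr (_ - _).
  (* Extension by zero moves the size condition into the summand, so that [sum_subset_pairs]
     applies. *)
  pose G A D : R := if (#|A| + #|D| < r)%N then
    (-1) ^+ (#|A| + #|D|) * (rho V A * rho [set j] D) * Z (I :\: (A :|: D)) else 0.
  transitivity (\sum_(A : {set T} | A \subset I)
      \sum_(D : {set T} | D \subset I :\: A) G A D).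
    rewrite [in RHS](bigID (fun A : {set T} => (#|A| <= r)%N)) /=.
    rewrite [X in _ = _ + X]big1 ?addr0; last first.
      move=> A /andP[_]; rewrite -ltnNge => rA; apply: big1 => D _.
      by rewrite /G ltnNge (leq_trans (ltnW rA)) ?leq_addr.
    apply: eq_bigr => A /andP[AI Ar]; rewrite big_distrr /= /G.
    rewrite -[RHS]big_mkcondr /=; apply: eq_big => D.
      by rewrite ltn_subRL.
    move=> _; rewrite exprD setDDl.
    by move: (_ ^+ _) (_ ^+ _) (rho _ _) (rho _ _) (Z _) => a b c d z; ring.
  rewrite -sum_subset_pairs [in RHS]big_mkcondr /=.
  apply: eq_bigr => B BI; case: ifP => Br.
    rewrite /conv [X in _ = X * _]mulr_sumr mulr_suml; apply: eq_bigr => A AB.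
    by rewrite /G setUDid_card // Br setUDid.
  by apply: big1 => A AB; rewrite /G setUDid_card // Br.
move: (avoid V I) (avoid _ I) => a b.
move: (\sum_(_ | _) _) (\sum_(_ | _) _) => c d.
move: (\sum_(_ | _) _) (\sum_(_ | _) _) => c' d'.
ring.
Qed.

Variable K : nat.
(** Through [avoidZ_setU_sum], removing all neighbours of [V] from [I] at most doubles [Z I]. *)
Hypothesis neighbours_half : forall V, connected_set e V -> (#|V| <= K)%N ->
  \sum_(j in neighbours e V) m [set j] <= 1 / 2.

Definition extension_sum r V I : R :=
  \sum_(W : {set T} | (W \subset I) && ((#|W| == r) && connected_set e (V :|: W)))
    m (V :|: W).

(** Cost of one more order: 1 for the remainder at [j |: V], [4 ^+ K * c] for the cross terms of
    [remainder_rec], and 2 for the return from [I] without the neighbours of [V] to [I]. *)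
Definition remainder_const : R := 2 * (1 + 4 ^+ K * cumulant_const R K).

Local Notation c := (cumulant_const R K).
Local Notation M := remainder_const.

Lemma extension_sum_ge0 r V I : 0 <= extension_sum r V I.
Proof. by apply: sumr_ge0. Qed.

Lemma remainder_const_ge1 : 1 <= M.
Proof.
have := cumulant_const_ge0 R K; have : 0 <= 4 ^+ K :> R by rewrite exprn_ge0.
by rewrite /M => a b; have := mulr_ge0 a b; lra.
Qed.

Lemma remainder_const_gt0 : 0 < M.
Proof. exact: lt_le_trans remainder_const_ge1. Qed.

(** The counterpart of [remainder_rec] for the bounds: an extension that uses [j] extends [j |: V]
    by one element fewer. *)
Lemma extension_sum_setU1 r V j I : j \notin I ->
  extension_sum r.+1 V (j |: I) =
  extension_sum r.+1 V I + extension_sum r (j |: V) I.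
Proof.
move=> jI; rewrite /extension_sum.
rewrite (big_subsetU1 (fun W => (#|W| == r.+1) && connected_set e (V :|: W))) //.
congr (_ + _); apply: eq_big => W; last by rewrite setUCA setUA.
case WI : (W \subset I) => //=.
have jW : j \notin W by apply: contraNN jI; apply: (subsetP WI).
by rewrite cardsU1 jW setUCA setUA.
Qed.

Lemma extension_sum0 V I : connected_set e V -> extension_sum 0 V I = m V.
Proof.
move=> cV; rewrite /extension_sum (big_pred1 set0) ?setU0 // => W /=.
rewrite cards_eq0; have [->|] := eqVneq W set0; last by rewrite andbF.
by rewrite sub0set setU0 cV.
Qed.

(** Without neighbours of [V] in [I], independence gives [avoid V I = m V * Z I]. This is the term
    of the empty set, and all other terms vanish because [V :|: A] is disconnected. *)
Lemma remainder_isolated r V I : connected_set e V -> [disjoint V & I] ->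
  I :&: neighbours e V = set0 -> remainder r.+1 V I = 0.
Proof.
move=> cV dVI nbI.
have V0 : V != set0 by case/andP: cV.
have nonb x : x \in I -> x \notin neighbours e V.
  move=> xI; apply/negP => xn.
  by have : x \in I :&: neighbours e V; [rewrite inE xI | rewrite nbI inE].
rewrite /remainder avoid_indep //; last first.
  move=> x y xV yI; apply/negP => exy; case/negP: (nonb y yI).
  rewrite inE (disjointFl dVI yI) /=; apply/exists_inP; exists x => //.
  by rewrite e_sym.
rewrite (bigD1 set0) ?sub0set ?cards0 //= big1; last first.
  move=> A /andP[/andP[AI _] /set0Pn[a aA]].
  rewrite (rel_cumulant_eq0 (e := e)) ?mulr0 ?mul0r //; apply/negP => cVA.
  have pVA : V \proper V :|: A.
    rewrite properE subsetUl subUset subxx /=; apply/negP => /subsetP/(_ _ aA).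
    by rewrite (disjointFl dVI (subsetP AI _ aA)).
  have [j] := connected_set_neighbour e_sym V0 pVA cVA.
  rewrite in_setU => /orP[jV|jA] jn; first by move: jn; rewrite inE jV.
  by case/negP: (nonb j (subsetP AI _ jA)).
by rewrite addr0 ?cards0 expr0 mul1r rel_cumulant0 // setD0 subrr.
Qed.

(** The factor [c] bounds [rho V B], one [2 ^+ K] pays for deleting [B] from [I], and the other
    counts the subsets [B] of a given [U = B :|: W]. Only connected [V :|: B] contribute, and the
    edge from [V] to [j] joins them to [j |: W]. *)
Lemma cross_term_le r V j I : connected_set e V -> j \in neighbours e V ->
    (r <= K)%N ->
    (forall s A, (s <= r)%N -> A \subset I ->
       `|remainder s [set j] A| <= M ^+ s * Z A * extension_sum s [set j] A) ->
  `|\sum_(B : {set T} | (B \subset I) && (#|B| <= r)%N)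
      (-1) ^+ #|B| * rho V B * remainder (r - #|B|)%N [set j] (I :\: B)|
  <= 4 ^+ K * c * M ^+ r * Z I * extension_sum r (j |: V) I.
Proof.
move=> cV jn rK IH.
pose H U := if (#|U| == r) && connected_set e ((j |: V) :|: U)
            then m ((j |: V) :|: U) else 0.
have H0 U : 0 <= H U by rewrite /H; case: ifP.
have c0 := cumulant_const_ge0 R K.
have M0 : 0 <= M by apply: ltW remainder_const_gt0.
apply: le_trans (ler_norm_sum _ _ _) _.
apply: (@le_trans _ _ (\sum_(B : {set T} | (B \subset I) && (#|B| <= r)%N)
    c * M ^+ r * (2 ^+ K * Z I) * \sum_(W : {set T} | W \subset I :\: B) H (B :|: W))).
  apply: ler_sum => B /andP[BI Br].
  rewrite !normrM normrX normrN1 expr1n mul1r.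
  have [cVB|ncVB] := boolP (connected_set e (V :|: B)); last first.
    rewrite (rel_cumulant_eq0 (e := e)) // normr0 mul0r !mulr_ge0 ?exprn_ge0 //.
    by apply: sumr_ge0.
  have BK : (#|B| <= K)%N := leq_trans Br rK.
  have MZ0 : 0 <= M ^+ r * (2 ^+ K * Z I) by rewrite !mulr_ge0 ?exprn_ge0.
  have rem : `|remainder (r - #|B|)%N [set j] (I :\: B)| <=
      M ^+ r * (2 ^+ K * Z I) * extension_sum (r - #|B|)%N [set j] (I :\: B).
    apply: le_trans (IH _ _ (leq_subr _ _) (subsetDl _ _)) _.
    apply: ler_wpM2r; first exact: extension_sum_ge0.
    apply: ler_pM; rewrite ?exprn_ge0 //.
      by apply: ler_weXn2l; rewrite ?leq_subr // remainder_const_ge1.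
    apply: le_trans (avoidZ_setD _ _) _; apply: ler_wpM2r => //.
    by rewrite ler_weXn2l // (ler_nat _ 1 2).
  apply: le_trans (ler_pM _ _ (rel_cumulant_le m0 m_ge0 m_sup V BK) rem) _ => //.
  rewrite mulrACA -mulrA -[X in _ <= X]mulrA -[X in _ <= X]mulrA.
  apply: ler_wpM2l => //; rewrite [leRHS]mulrA; apply: ler_wpM2l => //.
  rewrite /extension_sum mulr_sumr big_mkcondr; apply: ler_sum => W WIB.
  case: ifP => // /andP[/eqP Wr cjW]; rewrite /H.
  have E : (j |: V) :|: (B :|: W) = (V :|: B) :|: (j |: W).
    by rewrite [j |: V]setUC setUACA.
  have dBW : [disjoint B & W].
    by move: WIB; rewrite subsetD disjoint_sym => /andP[].
  have BWr : #|B :|: W| = r.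
    by rewrite cardsU (disjoint_setI0 dBW) cards0 subn0 Wr subnKC.
  rewrite E BWr eqxx /=.
  move: jn; rewrite inE => /andP[_ /exists_inP[x xV jx]].
  have -> : connected_set e ((V :|: B) :|: (j |: W)).
    apply: (connected_setU e_sym (x := x) (y := j)) => //.
    - by rewrite inE xV.
    - by rewrite setU11.
    - by rewrite e_sym.
  exact: m_sup.
rewrite -mulr_sumr.
have -> : 4 ^+ K = 2 ^+ K * 2 ^+ K :> R by rewrite -exprMn -natrM.
have -> : 2 ^+ K * 2 ^+ K * c * M ^+ r * Z I * extension_sum r (j |: V) I =
  c * M ^+ r * (2 ^+ K * Z I) * (2 ^+ K * extension_sum r (j |: V) I).
  move: (2 ^+ K) (M ^+ r) (Z I) c (extension_sum _ _ _) => a b d f g; ring.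
apply: ler_wpM2l; first by rewrite !mulr_ge0 ?exprn_ge0.
apply: (@le_trans _ _ (\sum_(B : {set T} | B \subset I)
    \sum_(W : {set T} | W \subset I :\: B) H (B :|: W))).
  rewrite big_mkcondr; apply: ler_sum => B _; case: ifP => // _.
  by apply: sumr_ge0.
rewrite -(sum_subset_pairs (fun B W => H (B :|: W))).
rewrite /extension_sum mulr_sumr big_mkcondr /=; apply: ler_sum => U UI.
rewrite (eq_bigr (fun=> H U)); last by move=> A AU; rewrite setUDid.
rewrite sumr_const /H; case: ifP => [/andP[/eqP Ur _]|]; last by rewrite mul0rn.
rewrite -[leLHS]mulr_natl; apply: ler_wpM2r => //.
rewrite -natrX ler_nat.
rewrite (_ : #|_| = #|powerset U|); first by rewrite card_powerset leq_exp2l // Ur.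
by apply: eq_card => A; rewrite !inE.
Qed.

(** Order 0 is Harris' inequality. For higher orders, an inner induction removes the neighbours of
    [V] from [I] one at a time by [remainder_rec], down to [remainder_isolated]; the other
    remainders there have lower order. *)
Lemma remainder_le r V I : connected_set e V -> [disjoint V & I] ->
    (#|V| + r <= K)%N ->
  `|remainder r V I| <= M ^+ r * Z I * extension_sum r V I.
Proof.
have c0 := cumulant_const_ge0 R K.
have M0 : 0 <= M by apply: ltW remainder_const_gt0.
have K0 : 0 <= 4 ^+ K :> R by rewrite exprn_ge0.
elim/ltn_ind: r V I => -[|r] IH V I cV dVI VrK.
  by rewrite remainder0 ger0_norm // extension_sum0 // expr0 mul1r mulrC.
have rK : (r < K)%N by exact: leq_trans (leq_addl _ _) VrK.
pose N := neighbours e V; pose Cst := (1 + 4 ^+ K * c) * M ^+ r.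
have Cst0 : 0 <= Cst by rewrite mulr_ge0 ?exprn_ge0 // addr_ge0 ?mulr_ge0.
(* The inner bound uses [Z (I :\: N)] because this quantity stays fixed while neighbours are removed
   and dominates every intermediate [Z I']. *)
suff inner : `|remainder r.+1 V I| <= Cst * Z (I :\: N) * extension_sum r.+1 V I.
  apply: le_trans inner _; apply: ler_wpM2r; first exact: extension_sum_ge0.
  have ZN : Z (I :\: N) <= 2 * Z I.
    have VK : (#|V| <= K)%N := leq_trans (leq_addr _ _) VrK.
    have h1 := neighbours_half cV VK.
    have h2 := avoidZ_setU_sum (I :\: N) N.
    have h3 : Z ((I :\: N) :|: N) <= Z I.
      by apply: avoidZ_anti; rewrite -{1}(setID I N) setUC; apply: setUS; apply: subsetIr.
    have := avoid_ge0 set0 (I :\: N); rewrite -/N in h1; nra.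
  apply: le_trans (ler_wpM2l Cst0 ZN) _.
  by rewrite le_eqVlt; apply/orP; left; apply/eqP; rewrite /Cst exprS /M; ring.
have [n] := ubnP #|I :&: N|; elim: n I dVI => // n IHn I dVI ltn.
have [nbI|/set0Pn[j]] := eqVneq (I :&: N) set0.
  rewrite remainder_isolated // normr0; apply: mulr_ge0 (extension_sum_ge0 _ _ _).
  exact: mulr_ge0.
rewrite inE => /andP[jI jN].
pose I' := I :\ j.
have IE : I = j |: I' by rewrite setD1K.
have jI' : j \notin I' by rewrite !inE eqxx.
have I'I : I' \subset I by apply: subsetDl.
have dVI' : [disjoint V & I'] by apply: disjointWr I'I dVI.
have jV : j \notin V by move: jN; rewrite inE => /andP[].
have I'N : I' :\: N = I :\: N.
  apply/setP => x; rewrite !inE; have [->|//] := eqVneq x j.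
  by move: jN; rewrite inE => ->.
have ZI' : Z I' <= Z (I :\: N) by apply: avoidZ_anti; rewrite -I'N subsetDl.
have b1 : `|remainder r.+1 V I'| <= Cst * Z (I :\: N) * extension_sum r.+1 V I'.
  rewrite -I'N; apply: IHn => //; rewrite -ltnS; apply: leq_trans ltn.
  rewrite ltnS; apply: proper_card; apply/properP; split; first exact: setSI.
  by exists j; rewrite inE ?jI ?jN // (negbTE jI').
have S0 := extension_sum_ge0 r (j |: V) I'.
have b2 : `|remainder r (j |: V) I'| <= M ^+ r * Z (I :\: N) * extension_sum r (j |: V) I'.
  apply: (@le_trans _ _ (M ^+ r * Z I' * extension_sum r (j |: V) I')).
    apply: IH => //; first exact: connected_setU1.
      rewrite -setI_eq0 setIUl setU_eq0 !setI_eq0 disjoints1 jI' /=.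
      exact: dVI'.
    by rewrite cardsU1 jV add1n addSnnS.
  by apply: ler_wpM2r => //; apply: ler_wpM2l => //; rewrite exprn_ge0.
have b3 := @cross_term_le r V j I' cV jN (ltnW rK).
rewrite IE remainder_rec // extension_sum_setU1 // -IE.
apply: le_trans (ler_normD _ _) _; apply: le_trans (lerD (ler_normB _ _) (b3 _)) _.
  move=> s A sr AI'; apply: IH => //; first exact: connected_set1.
    by rewrite disjoints1; apply: contraNN jI'; apply: (subsetP AI').
  by rewrite cards1 add1n (leq_ltn_trans sr).
apply: le_trans (lerD (lerD b1 b2) (ler_wpM2r S0 (ler_wpM2l _ ZI'))) _.
  by rewrite !mulr_ge0 ?exprn_ge0.
by rewrite le_eqVlt; apply/orP; left; apply/eqP; rewrite /Cst; ring.
Qed.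

Lemma avoidZ_ratio I A : A \subset I ->
  `|Z (I :\: A) / Z I - 1| <= 2 ^+ #|A| * \sum_(a in A) m [set a].
Proof.
move=> AI; have Z0 := avoidZ_gt0 I.
have -> : Z (I :\: A) / Z I - 1 = (Z (I :\: A) - Z I) / Z I.
  by rewrite mulrBl divff // gt_eqF.
rewrite normrM (gtr0_norm (_ : 0 < (Z I)^-1)) ?invr_gt0 // ler_pdivrMr //.
rewrite ger0_norm; last by rewrite subr_ge0 avoidZ_anti // subsetDl.
have h1 := avoidZ_setU_sum (I :\: A) A.
have e1 : (I :\: A) :|: A = I by rewrite setUC setUDid.
rewrite e1 mulrBr mulr1 in h1.
apply: (@le_trans _ _ (Z (I :\: A) * \sum_(a in A) m [set a])); first by lra.
rewrite mulrAC; apply: ler_wpM2r; last exact: avoidZ_setD.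
exact: sumr_ge0.
Qed.

(** * Expansion of the logarithm, one edge at a time *)

Variables (ell : R -> R) (k : nat).
(* [ell] stands for the logarithm. *)
Hypotheses (ell1 : ell 1 = 0)
  (ellM : forall z x, 0 < z -> 0 <= x <= 1 / 2 ->
            `|ell (z * (1 - x)) - ell z + x| <= 2 * x ^+ 2)
  (kK : (k < K)%N).

(** The three errors come from linearizing the logarithm, from truncating the expansion of [avoid
    [set j] I], and from replacing the ratios [Z (I :\: A) / Z I] by 1. *)
Lemma log_avoid_step j I : j \notin I ->
  `|ell (Z (j |: I)) - ell (Z I)
    + \sum_(A : {set T} | (A \subset I) && ((#|A| < k)%N && connected_set e (j |: A)))
        (-1) ^+ #|A| * joint_cumulant m (j |: A)|
  <= 2 * m [set j] ^+ 2 + M ^+ k * extension_sum k [set j] I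
     + c * 2 ^+ K *
       \sum_(A : {set T} | (A \subset I) && ((#|A| < k)%N && connected_set e (j |: A)))
          m (j |: A) * \sum_(a in A) m [set a].
Proof.
move=> jI; have Z0 := avoidZ_gt0 I; have Zn0 : Z I != 0 by rewrite gt_eqF.
(* The conditional probability that [j] occurs given that nothing in [I] does; adding [j] multiplies
   [Z I] by [1 - s]. *)
pose s := avoid [set j] I / Z I.
have sZ : Z I * s = avoid [set j] I by rewrite /s mulrC divfK.
have s0 : 0 <= s by rewrite divr_ge0 // ltW.
have sm : s <= m [set j] by rewrite ler_pdivrMr.
have mj := m1_half j.
have h1 : `|ell (Z (j |: I)) - ell (Z I) + s| <= 2 * m [set j] ^+ 2.
  rewrite avoid_setU1 // setU0 -sZ -{1}[Z I]mulr1 -mulrBr.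
  apply: le_trans (ellM Z0 _) _; first by rewrite s0 (le_trans sm).
  by apply: ler_wpM2l => //; rewrite ler_sqr ?nnegrE.
have h2 : `|remainder k [set j] I / Z I| <= M ^+ k * extension_sum k [set j] I.
  rewrite normrM (gtr0_norm (_ : 0 < (Z I)^-1)) ?invr_gt0 // ler_pdivrMr //.
  rewrite mulrAC; apply: remainder_le; first exact: connected_set1.
    by rewrite disjoints1.
  by rewrite cards1 add1n.
set Q := fun A : {set T} => (A \subset I) && ((#|A| < k)%N && connected_set e (j |: A)).
pose D := \sum_(A | Q A) (-1) ^+ #|A| * rho [set j] A * (Z (I :\: A) / Z I - 1).
have h3 : `|D| <= c * 2 ^+ K * \sum_(A | Q A) m (j |: A) * \sum_(a in A) m [set a].
  apply: le_trans (ler_norm_sum _ _ _) _; rewrite mulr_sumr; apply: ler_sum => A.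
  move=> /and3P[AI Ak _]; rewrite !normrM normrX normrN1 expr1n mul1r.
  have AK : (#|A| <= K)%N by apply: ltnW; apply: ltn_trans Ak kK.
  have rhoA := rel_cumulant_le m0 m_ge0 m_sup [set j] AK.
  apply: le_trans (ler_pM _ _ rhoA (avoidZ_ratio AI)) _ => //.
  rewrite mulrACA; apply: ler_wpM2r.
    by rewrite mulr_ge0 // sumr_ge0.
  apply: ler_wpM2l; first exact: cumulant_const_ge0.
  by rewrite ler_weXn2l // (ler_nat _ 1 2).
have jcE A : A \subset I -> joint_cumulant m (j |: A) = rho [set j] A.
  move=> AI; rewrite joint_cumulantE //.
  by apply: contraNN jI; apply: (subsetP AI).
have sE : s = \sum_(A | Q A) (-1) ^+ #|A| * joint_cumulant m (j |: A) + D
              + remainder k [set j] I / Z I.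
  rewrite /remainder mulrBl -/s mulr_suml addrCA -[LHS]addr0; congr (_ + _).
  rewrite /D -big_split /=; apply/esym/eqP; rewrite subr_eq0; apply/eqP.
  rewrite [RHS](bigID (fun A : {set T} => connected_set e (j |: A))) /=.
  rewrite [X in _ = _ + X]big1 ?addr0; last first.
    move=> A /andP[_ nc].
    by rewrite (rel_cumulant_eq0 (e := e)) ?mulr0 ?mul0r //; apply: connected_set1.
  apply: eq_big => A; first by rewrite /Q andbA.
  move=> /andP[AI _]; rewrite jcE //.
  by move: (_ ^+ _) (rho _ _) (Z (_ :\: _)) (Z I)^-1 => u v z w; ring.
set B1 := 2 * _; set B2 := M ^+ k * _; set B3 := c * _ * _.
set S := \sum_(A | Q A) _ in sE *.
have -> : ell (Z (j |: I)) - ell (Z I) + S =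
  (ell (Z (j |: I)) - ell (Z I) + s) - remainder k [set j] I / Z I - D.
  by rewrite sE; ring.
apply: le_trans (ler_normB _ _) _; apply: lerD => //.
apply: le_trans (ler_normB _ _) _; exact: lerD.
Qed.

(** The steps telescope: each connected [V] is accounted for when the last of its elements is added,
    as [V = j |: A], which turns the sign of [A] into minus that of [V]. *)
Lemma log_avoid_expansion I :
  `|ell (Z I) - \sum_(V : {set T} | (V \subset I) && ((#|V| <= k)%N && connected_set e V))
                   (-1) ^+ #|V| * joint_cumulant m V|
  <= 2 * \sum_(i in I) m [set i] ^+ 2
     + M ^+ k * \sum_(V : {set T} | (V \subset I) && ((#|V| == k.+1) && connected_set e V)) m V
     + c * 2 ^+ K *
       \sum_(V : {set T} | (V \subset I) && ((#|V| <= k)%N && connected_set e V))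
          m V * \sum_(a in V) m [set a].
Proof.
have c0 := cumulant_const_ge0 R K.
have M0 : 0 <= M by apply: ltW remainder_const_gt0.
elim/setU1_ind: I => [|j I jI IH].
  have none b V : (V \subset set0) && (b && connected_set e V) = false.
    rewrite subset0; have [->|//] := eqVneq V set0.
    by rewrite /connected_set eqxx andbF.
  by rewrite avoid0 m0 ell1 big_set0 !big_pred0 ?subrr ?normr0 ?mulr0 ?addr0.
have cU A : A \subset I -> #|j |: A| = #|A|.+1.
  move=> AI; rewrite cardsU1 (_ : j \notin A) //.
  by apply: contraNN jI; apply: (subsetP AI).
rewrite big_setU1 //= !big_subsetU1 //=.
have step := log_avoid_step jI.
rewrite [X in _ - (_ + X)](_ : _ = - \sum_(A : {set T} |
     (A \subset I) && ((#|A| < k)%N && connected_set e (j |: A)))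
        (-1) ^+ #|A| * joint_cumulant m (j |: A)); last first.
  rewrite -sumrN; apply: eq_big => A.
    by case AI : (A \subset I) => //=; rewrite cU.
  by move=> /andP[AI _]; rewrite cU // exprS -mulrA mulN1r.
rewrite [X in _ + M ^+ k * (_ + X)](_ : _ = extension_sum k [set j] I); last first.
  apply: eq_bigl => A.
  by case AI : (A \subset I) => //=; rewrite cU.
set Y' := (X in _ <= _ + _ * X) in step.
set Y := (X in _ <= _ + _ * X) in IH.
set W := (X in _ <= _ + _ * (_ + X)).
(* The step sums over [A] only; the bound also allows the term of [j] itself. *)
have YW : Y' <= W.
  rewrite /Y' /W; under [leRHS]eq_bigl => A.
    rewrite (_ : _ && _ = (A \subset I) &&
        ((#|A| < k)%N && connected_set e (j |: A))); last first.
      by case AI : (A \subset I) => //=; rewrite cU.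
  over.
  apply: ler_sum => A /andP[AI _]; apply: ler_wpM2l => //.
  rewrite big_setU1 ?lerDr //=.
  by apply: contraNN jI; apply: (subsetP AI).
have cYW : c * 2 ^+ K * Y' <= c * 2 ^+ K * W.
  by apply: ler_wpM2l => //; rewrite mulr_ge0 // exprn_ge0.
move: IH step cYW; rewrite !mulrDr -/Y.
rewrite opprD opprK.
move: (c * _ * Y) (c * _ * Y') (c * _ * W) (M ^+ k * _) (M ^+ k * _) => y1 y2 y3 x1 x2.
move: (2 * \sum_(i in I) _) (2 * m [set j] ^+ 2) => d1 d2.
rewrite !ler_norml => /andP[A1 A2] /andP[A3 A4] A5; lra.
Qed.

(** * Connected sets through a given vertex *)

Variable L : R.
Hypotheses (L_ge0 : 0 <= L)
  (growth : forall V, connected_set e V -> (#|V| <= K)%N ->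
     \sum_(j in neighbours e V) m (j |: V) <= L * m V).

(** By [connected_set_pred] every larger connected set through [a] is a smaller one plus a
    neighbour, and [growth] bounds the total over neighbours by a factor [L]. *)
Lemma rooted_sum_le a s : (s <= K)%N ->
  \sum_(V : {set T} | [&& a \in V, #|V| == s.+1 & connected_set e V]) m V
  <= L ^+ s * m [set a].
Proof.
elim: s => [|s IH] sK.
  rewrite (big_pred1 [set a]) ?expr0 ?mul1r // => V /=.
  apply/and3P/eqP => [[aV /cards1P[x Vx] _]|->].
    by move: aV; rewrite Vx inE => /eqP ->.
  by rewrite inE eqxx cards1 connected_set1.
rewrite exprS -mulrA.
apply: le_trans (ler_wpM2l L_ge0 (IH (ltnW sK))); rewrite mulr_sumr.
apply: (@le_trans _ _ (\sum_(V : {set T} | [&& a \in V, #|V| == s.+1 & connected_set e V])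
    \sum_(j in neighbours e V) m (j |: V))); last first.
  by apply: ler_sum => V /and3P[_ /eqP Vs cV]; apply: growth => //; rewrite Vs.
pose good U := [&& a \in U, #|U| == s.+2 & connected_set e U].
apply: (@le_trans _ _ (\sum_(V : {set T} | [&& a \in V, #|V| == s.+1 & connected_set e V])
    \sum_(j in neighbours e V) \sum_(U | good U && (U == j |: V)) m U)).
  rewrite -/good.
  rewrite [leRHS](eq_bigr (fun V : {set T} => \sum_(U | good U)
    \sum_(j | (j \in neighbours e V) && (good U && (U == j |: V))) m U)); last first.
    by move=> V _; rewrite (exchange_big_dep good) //= => j U _ /andP[].
  rewrite (exchange_big_dep good) //=; apply: ler_sum => U gU.
  have /and3P[aU /eqP Us cU] := gU.
  (* One such decomposition of [U] suffices: further ones only add nonnegative terms. *)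
  have [|V [j [cV aV jV UE]]] := connected_set_pred e_sym cU aU; first by rewrite Us.
  have jnV : j \notin V by move: jV; rewrite inE => /andP[].
  have Vs : #|V| == s.+1 by rewrite -eqSS -Us UE cardsU1 jnV.
  rewrite (bigD1 V) /=; last by rewrite aV Vs cV.
  rewrite (bigD1 j) /=; last by apply/and3P; split=> //; apply/eqP.
  rewrite -addrA lerDl; apply: addr_ge0; first exact: sumr_ge0.
  by apply: sumr_ge0 => V' _; apply: sumr_ge0.
apply: ler_sum => V _; apply: ler_sum => j _.
have [gU|ngU] := boolP (good (j |: V)).
  rewrite (big_pred1 (j |: V)) // => U /=.
  by have [->|] := eqVneq U (j |: V); rewrite ?gU ?andbF.
rewrite big_pred0 // => U; have [->|] := eqVneq U (j |: V); last by rewrite andbF.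
by rewrite (negbTE ngU).
Qed.

Lemma rooted_sum_leq a r : (r <= K)%N ->
  \sum_(V : {set T} | [&& a \in V, (#|V| <= r)%N & connected_set e V]) m V
  <= (\sum_(s < r) L ^+ s) * m [set a].
Proof.
elim: r => [|r IH] rK.
  rewrite big_ord0 mul0r big_pred0 // => V; rewrite leqn0 cards_eq0.
  by have [->|] := eqVneq V set0; rewrite ?inE ?andbF.
rewrite big_ord_recr /= mulrDl.
apply: le_trans (lerD (IH (ltnW rK)) (rooted_sum_le a (ltnW rK))).
rewrite (bigID (fun V : {set T} => (#|V| <= r)%N)) /=.
rewrite le_eqVlt; apply/orP; left; apply/eqP; congr (_ + _); apply: eq_bigl => V.
  case: (a \in V) => //=; case: (connected_set e V); rewrite ?andbF ?andbT //.
  by rewrite leq_eqVlt ltnS; case: (#|V| <= r)%N; rewrite ?orbT ?andbF ?andbT.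
case: (a \in V) => //=; case: (connected_set e V); rewrite ?andbF ?andbT //.
by rewrite -ltnNge -eqn_leq eq_sym.
Qed.

Definition expansion_const : R := 2 + M ^+ k + c * 2 ^+ K * \sum_(s < k) L ^+ s.

Lemma log_avoid_bound :
  `|ell (Z [set: T]) - \sum_(V : {set T} | (#|V| <= k)%N && connected_set e V)
                   (-1) ^+ #|V| * joint_cumulant m V|
  <= expansion_const * (\sum_i m [set i] ^+ 2
       + \sum_(V : {set T} | (#|V| == k.+1) && connected_set e V) m V).
Proof.
have c0 := cumulant_const_ge0 R K.
have M0 : 0 <= M ^+ k by rewrite exprn_ge0 // ltW // remainder_const_gt0.
have := log_avoid_expansion [set: T].
under eq_bigl => V do rewrite subsetT.
under [X in _ + M ^+ k * X]eq_bigl => V do rewrite subsetT.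
under [X in _ + _ * X]eq_bigl => V do rewrite subsetT.
under [X in 2 * X]eq_bigl => V do rewrite inE.
move=> h; apply: le_trans h _.
set d := \sum_i _; set x := \sum_(V | _) m V; set y := \sum_(V | _) _ * _.
(* Exchanging the sums leaves, for each [a], the sum of [m V] over [V] through [a]; the rooted bound
   supplies a second factor [m [set a]]. *)
have y_le : y <= (\sum_(s < k) L ^+ s) * d.
  rewrite /y.
  under eq_bigr => V _ do rewrite mulr_sumr.
  rewrite (exchange_big_dep predT) //= /d mulr_sumr; apply: ler_sum => a _.
  rewrite -mulr_suml expr2 mulrA; apply: ler_wpM2r => //.
  apply: le_trans (rooted_sum_leq a (ltnW kK)).
  rewrite le_eqVlt; apply/orP; left; apply/eqP; apply: eq_bigl => V.
  by rewrite andbC.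
have cy : c * 2 ^+ K * y <= c * 2 ^+ K * (\sum_(s < k) L ^+ s) * d.
  by rewrite -[leRHS]mulrA; apply: ler_wpM2l; rewrite ?mulr_ge0 ?exprn_ge0.
have d0 : 0 <= d by apply: sumr_ge0 => i _; rewrite sqr_ge0.
have x0 : 0 <= x by apply: sumr_ge0.
have s0 : 0 <= c * 2 ^+ K * (\sum_(s < k) L ^+ s).
  by rewrite !mulr_ge0 ?exprn_ge0 // sumr_ge0 // => s _; rewrite exprn_ge0.
rewrite /expansion_const; move: cy s0; set q := c * 2 ^+ K * \sum_(s < k) L ^+ s.
move: (c * _ * y) q (M ^+ k) M0 => cy' q mk mk0 A1 A2.
have := mulr_ge0 mk0 d0; have := mulr_ge0 A2 x0; nra.
Qed.

End Avoidance.

(** * Binomial random subsets *)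

Section RandomSubset.
Variables (R : realFieldType) (Omega : finType) (p : Omega -> R).
Hypothesis p01 : forall w, 0 < p w < 1.
Implicit Types (S A B : {set Omega}).

Lemma p_gt0 w : 0 < p w. Proof. by case/andP: (p01 w). Qed.
Lemma p_le1 w : p w <= 1. Proof. by case/andP: (p01 w) => _ /ltW. Qed.

Lemma weight_ge0 S : 0 <= weight p S.
Proof.
rewrite mulr_ge0 // prodr_ge0 // => w _; first exact: ltW (p_gt0 w).
by rewrite subr_ge0 p_le1.
Qed.

Lemma sum_weight : \sum_S weight p S = 1.
Proof.
transitivity (\prod_w (p w + (1 - p w))); last first.
  by rewrite big1 // => w _; rewrite addrC subrK.
rewrite bigA_distr /=; apply: eq_bigr => S _; rewrite /weight.
rewrite [RHS](bigID (mem S)) /=; congr (_ * _).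
  by apply: eq_bigr => w wS; rewrite wS.
by apply: eq_big => w; rewrite inE // => /negbTE ->.
Qed.

Lemma sum_weight_mem b (h : {set Omega} -> R) :
  \sum_(S : {set Omega} | b \in S) weight p S * h S =
  p b * \sum_S weight p S * h (b |: S).
Proof.
have bb : b \notin [set~ b] by rewrite !inE eqxx.
have bU : b |: [set~ b] = [set: Omega] by apply/setP => x; rewrite !inE orbN.
have split (P : pred {set Omega}) (F : {set Omega} -> R) : \sum_(S | P S) F S =
    \sum_(S : {set Omega} | (S \subset [set~ b]) && P S) F S +
    \sum_(S : {set Omega} | (S \subset [set~ b]) && P (b |: S)) F (b |: S).
  by rewrite -big_subsetU1 // bU; apply: eq_bigl => S; rewrite subsetT.
(* For [S] avoiding [b], the weight of [S] as a subset of the remaining vertices. *)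
pose u S := (\prod_(w in S) p w) * \prod_(w in ~: (b |: S)) (1 - p w).
have wb S : S \subset [set~ b] -> weight p (b |: S) = p b * u S.
  move=> Sb; have bS : b \notin S by apply: contraNN bb; apply: (subsetP Sb).
  by rewrite /weight big_setU1 //= -mulrA.
have wn S : S \subset [set~ b] -> weight p S = (1 - p b) * u S.
  move=> Sb; have bS : b \notin S by apply: contraNN bb; apply: (subsetP Sb).
  rewrite /weight /u mulrCA; congr (_ * _).
  rewrite (bigD1 b) ?inE //=; congr (_ * _); apply: eq_bigl => w.
  by rewrite !inE negb_or andbC.
rewrite split [X in X + _]big1 ?add0r; last first.
  move=> S /andP[Sb bS]; case/negP: bb; exact: (subsetP Sb).
rewrite (split predT (fun S => weight p S * h (b |: S))) -big_split /= mulr_sumr.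
apply: eq_big => S; first by rewrite setU11.
move=> /andP[Sb _]; rewrite wb // wn // setUA setUid; ring.
Qed.

(** Conditioned on containing [B], the random set is distributed as its union with [B]. *)
Lemma sum_weight_superset B (h : {set Omega} -> R) :
  \sum_(S : {set Omega} | B \subset S) weight p S * h S =
  (\prod_(w in B) p w) * \sum_S weight p S * h (B :|: S).
Proof.
elim/setU1_ind: B h => [|b B bB IH] h.
  rewrite big_set0 mul1r; apply: eq_big => S; first by rewrite sub0set.
  by rewrite set0U.
rewrite big_setU1 //= [p b * _]mulrC -mulrA.
transitivity (\sum_(S : {set Omega} | B \subset S)
    weight p S * (if b \in S then h S else 0)).
  rewrite (eq_bigl (fun S => (B \subset S) && (b \in S))); last first.
    by move=> S; rewrite subUset sub1set andbC.
  rewrite big_mkcondr; apply: eq_bigr => S _; by case: ifP; rewrite ?mulr0.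
rewrite IH; congr (_ * _).
transitivity (\sum_(S : {set Omega} | b \in S) weight p S * h (B :|: S)).
  rewrite [RHS]big_mkcond; apply: eq_bigr => S _; rewrite inE (negbTE bB) /=.
  by case: ifP; rewrite ?mulr0.
rewrite sum_weight_mem; congr (_ * _); apply: eq_bigr => S _.
by rewrite setUCA setUA.
Qed.

Lemma prod_p_gt0 A : 0 < \prod_(w in A) p w.
Proof. by apply: prodr_gt0 => w _; apply: p_gt0. Qed.

Lemma prod_p_le1 A : \prod_(w in A) p w <= 1.
Proof. by apply: prodr_ile1 => w _; rewrite p_le1 ltW // p_gt0. Qed.

Lemma prod_p_setUI A B :
  (\prod_(w in A) p w) * (\prod_(w in B) p w) =
  (\prod_(w in A :|: B) p w) * (\prod_(w in A :&: B) p w).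
Proof.
rewrite (big_setID A) /= [X in _ = X * _](big_setID A) /=.
rewrite setDv big_set0 mulr1 setIid setUK setDUl setDv set0U.
rewrite [X in _ * X](big_setID A) /= setIC; ring.
Qed.

Lemma p_le_max w : p w <= max_prob p.
Proof. exact: le_bigmax. Qed.

Lemma prod_p_le_max A : A != set0 -> \prod_(w in A) p w <= max_prob p.
Proof.
case/set0Pn => a aA; rewrite (big_setD1 a) //=.
apply: le_trans (p_le_max a); rewrite ler_piMr ?prod_p_le1 //.
exact: ltW (p_gt0 a).
Qed.

End RandomSubset.

(** * Edge indicators of a hypergraph *)

Section Hypergraph.
Variables (R : realFieldType) (Omega : finType).
Variables (X : {set {set Omega}}) (p : Omega -> R).
Hypothesis p01 : forall w, 0 < p w < 1.
Hypothesis X_nonempty : forall g, g \in X -> (0 < #|g|)%N.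
Local Notation N := #|X|.
Implicit Types (V I A B : {set 'I_N}) (S : {set Omega}) (i j : 'I_N).

Definition edge_union V : {set Omega} := \bigcup_(i in V) edge i.

Definition moment V : R := Ex p (indV V).

Lemma ind_unionE V S : indV V S = (edge_union V \subset S)%:R :> R.
Proof.
rewrite /indV; have [VS|] := boolP (edge_union V \subset S).
  rewrite big1 // => i iV; rewrite /ind (_ : edge i \subset S) //.
  by move/bigcupsP: VS; apply.
move=> nVS; apply/eqP; rewrite prodf_seq_eq0.
apply: contraNT nVS => /hasPn nh; apply/bigcupsP => i iV.
have := nh i (mem_index_enum i); rewrite iV /ind pnatr_eq0 eqb0 negbK.
by [].
Qed.

Lemma momentE V : moment V = \prod_(w in edge_union V) p w.
Proof.
rewrite /moment /Ex.
transitivity (\sum_(S : {set Omega} | edge_union V \subset S) weight p S * 1).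
  rewrite [RHS]big_mkcond; apply: eq_bigr => S _; rewrite ind_unionE.
  by case: ifP; rewrite ?mulr0.
rewrite (sum_weight_superset p _ (fun=> 1)).
by under [X in _ * X]eq_bigr => S _ do rewrite mulr1; rewrite sum_weight mulr1.
Qed.

Lemma moment0 : moment set0 = 1.
Proof. by rewrite momentE /edge_union !big_set0. Qed.

Lemma moment_gt0 V : 0 < moment V.
Proof. by rewrite momentE prod_p_gt0. Qed.

Lemma moment_ge0 V : 0 <= moment V. Proof. exact: ltW (moment_gt0 V). Qed.

Lemma edge_unionU A B : edge_union (A :|: B) = edge_union A :|: edge_union B.
Proof. exact: bigcup_setU. Qed.

Lemma edge_union1 i : edge_union [set i] = edge i.
Proof. by rewrite /edge_union big_set1. Qed.

(** The left side counts the vertices common to both unions twice, and their probabilities are at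
    most 1. *)
Lemma moment_sup A B : moment A * moment B <= moment (A :|: B).
Proof.
rewrite !momentE prod_p_setUI -edge_unionU ler_piMr ?prod_p_le1 //.
exact: ltW (prod_p_gt0 p01 _).
Qed.

Lemma dep_sym : symmetric (@dep _ X).
Proof. by move=> i j; rewrite /dep eq_sym setIC. Qed.

Lemma moment_indep A B : [disjoint A & B] ->
  (forall a b, a \in A -> b \in B -> ~~ dep a b) ->
  moment (A :|: B) = moment A * moment B.
Proof.
move=> dAB noe; rewrite !momentE prod_p_setUI -edge_unionU.
suff -> : edge_union A :&: edge_union B = set0 by rewrite big_set0 mulr1.
apply/setP => w; rewrite !inE; apply/negbTE/negP.
move=> /andP[/bigcupP[a aA wa] /bigcupP[b bB wb]].
case/negP: (noe a b aA bB); rewrite /dep; apply/andP; split.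
  by apply/eqP => ab; move: bB; rewrite -ab (disjointFr dAB aA).
by apply/set0Pn; exists w; rewrite inE wa.
Qed.

Definition none_in I S : R := \prod_(i in I) (1 - ind i S).

Lemma none_in_ge0 I S : 0 <= none_in I S.
Proof.
apply: prodr_ge0 => i _; rewrite /ind.
by case: (_ \subset _); rewrite ?subrr ?subr0.
Qed.

Lemma none_in_anti I S S' : none_in I (S' :|: S) <= none_in I S.
Proof.
apply: ler_prod => i _; rewrite /ind.
have [iS|niS] := boolP (edge i \subset S).
  by rewrite (subset_trans iS (subsetUr _ _)) subrr lexx.
by case: (edge i \subset _); rewrite ?subrr ?subr0 ?ler01 ?lexx.
Qed.

(** Undoes the inclusion-exclusion, which makes nonnegativity and Harris' inequality accessible. *)
Lemma avoid_momentE V I :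
  avoid moment V I =
  \sum_(S : {set Omega} | edge_union V \subset S) weight p S * none_in I S.
Proof.
elim/setU1_ind: I V => [|j I jI IH] V.
  rewrite avoid0 /moment /Ex [RHS]big_mkcond; apply: eq_bigr => S _.
  by rewrite ind_unionE /none_in big_set0; case: ifP; rewrite ?mulr0.
rewrite avoid_setU1 // !IH.
have -> : \sum_(S : {set Omega} | edge_union (j |: V) \subset S) weight p S * none_in I S
  = \sum_(S : {set Omega} | edge_union V \subset S) weight p S * none_in I S * ind j S.
  rewrite (eq_bigl (fun S => (edge_union V \subset S) && (edge j \subset S))); last first.
    by move=> S; rewrite edge_unionU edge_union1 subUset andbC.
  rewrite big_mkcondr; apply: eq_bigr => S _; rewrite /ind.
  by case: (edge j \subset S); rewrite ?mulr0 ?mulr1.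
rewrite -sumrB; apply: eq_bigr => S _.
by rewrite /none_in big_setU1 //=; ring.
Qed.

Lemma avoid_moment_ge0 V I : 0 <= avoid moment V I.
Proof.
rewrite avoid_momentE; apply: sumr_ge0 => S _.
by rewrite mulr_ge0 ?weight_ge0 ?none_in_ge0.
Qed.

(* Harris' inequality: conditioning on [edge_union V] being present amounts to
   adding it to the random set, which can only decrease [none_in I]. *)
Lemma avoid_moment_le V I :
  avoid moment V I <= moment V * avoid moment set0 I.
Proof.
rewrite !avoid_momentE sum_weight_superset momentE.
apply: ler_wpM2l; first exact: ltW (prod_p_gt0 p01 _).
rewrite [leRHS](eq_bigl predT); last first.
  by move=> S; rewrite /edge_union big_set0 sub0set.
apply: ler_sum => S _; apply: ler_wpM2l; first exact: weight_ge0.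
exact: none_in_anti.
Qed.

Lemma Pr_no_edge :
  Pr p (fun S => num_edges_in X S == 0%N) = avoid moment set0 [set: 'I_N].
Proof.
rewrite avoid_momentE /Pr big_mkcond [RHS]big_mkcond; apply: eq_bigr => S _.
rewrite /edge_union big_set0 sub0set /num_edges_in cards_eq0.
have [/eqP XS|/set0Pn[g]] := boolP (_ == set0).
  rewrite /none_in big1 ?mulr1 // => i _; rewrite /ind.
  case iS : (edge i \subset S); last by rewrite subr0.
  have : edge i \in [set g in X | g \subset S] by rewrite inE iS enum_valP.
  by rewrite XS inE.
rewrite inE => /andP[gX gS]; pose i := enum_rank_in gX g.
have gi : edge i = g by rewrite /edge enum_rankK_in.
by rewrite /none_in (bigD1 i) ?inE //= /ind [edge i]gi gS subrr mul0r mulr0.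
Qed.

Lemma moment1_le_max i : moment [set i] <= max_prob p.
Proof.
rewrite momentE edge_union1; apply: prod_p_le_max => //.
by rewrite -card_gt0 X_nonempty // enum_valP.
Qed.

Lemma indV_eq1 V S : (indV V S == 1 :> R) = (edge_union V \subset S).
Proof. by rewrite ind_unionE; case: (_ \subset _); rewrite ?eqxx // eq_sym oner_eq0. Qed.

Lemma condEx_ind V i :
  condEx p (ind i) (fun S => indV V S == 1 :> R) = moment (i |: V) / moment V.
Proof.
rewrite /condEx /Pr /moment /Ex; congr (_ / _).
  rewrite big_mkcond; apply: eq_bigr => S _.
  rewrite indV_eq1 ind_unionE edge_unionU edge_union1 subUset /ind.
  by case: (edge i \subset S); case: ifP; rewrite ?mulr0.
rewrite big_mkcond; apply: eq_bigr => S _; rewrite indV_eq1 ind_unionE.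
by case: ifP; rewrite ?mulr0 ?mulr1.
Qed.

Lemma lambdaM V :
  lambda p V * moment V = \sum_(i in boundary V) moment (i |: V).
Proof.
rewrite /lambda mulr_suml; apply: eq_bigr => i _.
by rewrite condEx_ind divfK // gt_eqF // moment_gt0.
Qed.

Lemma lambda_le_Lambda k V : (1 <= #|V| <= k)%N -> lambda p V <= Lambda X p k.
Proof. exact: (@le_bigmax_cond _ _ _ _ _ _ (lambda p)). Qed.

(** Edge [i] shares a vertex with an edge of [V], whose probability the product of moments counts
    twice. Summed over the boundary, this bounds the total of E[X_i] by [max_prob p] times
    [lambda p V]. *)
Lemma moment_boundary V i : i \in boundary V ->
  moment [set i] * moment V <= max_prob p * moment (i |: V).
Proof.
rewrite inE => /andP[_ /exists_inP[j jV /andP[_ /set0Pn[w]]]].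
rewrite inE => /andP[wi wj].
rewrite !momentE prod_p_setUI -edge_unionU mulrC; apply: ler_wpM2r.
  exact: ltW (prod_p_gt0 p01 _).
apply: prod_p_le_max => //; apply/set0Pn; exists w; rewrite inE edge_union1 wi.
by apply/bigcupP; exists j.
Qed.

Lemma sum_conn_sets1 (F : {set 'I_N} -> R) :
  \sum_(V in conn_sets X 1) F V = \sum_i F [set i].
Proof.
rewrite (_ : conn_sets X 1 = [set [set i] | i in 'I_N]).
  rewrite big_imset //=; last by move=> i j _ _; apply: set1_inj.
apply/setP => V; rewrite inE; apply/andP/imsetP => [[/cards1P[i ->] _]|[i _ ->]].
  by exists i.
rewrite cards1; split=> //; exact: (connected_set1 (@dep _ X)).
Qed.

Lemma deltaE : delta X p 1 = \sum_i moment [set i] ^+ 2.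
Proof.
rewrite /delta sum_conn_sets1; apply: eq_bigr => i _.
have eqE : Ex p (ind i) = moment [set i].
  by rewrite /moment /Ex; apply: eq_bigr => S _; rewrite /indV big_set1.
rewrite big_set1E eqE -/(moment _) expr2; congr (_ * _).
(* The default 0 of the maximum is harmless since moments are nonnegative. *)
by apply: max_idPl; rewrite moment_ge0.
Qed.

Lemma sum_kappaE k :
  \sum_(1 <= j < k.+1) (-1) ^+ j * kappa X p j =
  \sum_(V : {set 'I_N} | (#|V| <= k)%N && connected_set (@dep _ X) V)
     (-1) ^+ #|V| * joint_cumulant moment V.
Proof.
elim: k => [|k IH].
  rewrite big_geq // big_pred0 // => V; rewrite leqn0 cards_eq0 /connected_set.
  by case: (V == set0).
rewrite big_nat_recr //= IH [RHS](bigID (fun V : {set 'I_N} => (#|V| <= k)%N)) /=.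
congr (_ + _).
  apply: eq_bigl => V; case: (leqP #|V| k) => [Vk|_]; last by rewrite andbF.
  by rewrite (leqW Vk) andbT.
rewrite /kappa mulr_sumr; apply: eq_big => V.
  rewrite inE [RHS]andbAC; congr (_ && _).
  by rewrite -ltnNge -eqn_leq eq_sym.
by rewrite inE => /andP[/eqP -> _].
Qed.

Lemma log_Pr_no_edge_expansion (ell : R -> R) (k : nat) (L : R) :
    ell 1 = 0 ->
    (forall z x, 0 < z -> 0 <= x <= 1 / 2 ->
       `|ell (z * (1 - x)) - ell z + x| <= 2 * x ^+ 2) ->
    0 <= L -> Lambda X p k.+1 <= L ->
    max_prob p <= 1 / 2 -> max_prob p * L <= 1 / 2 ->
  `|ell (Pr p (fun S => num_edges_in X S == 0%N))
    - \sum_(1 <= j < k.+1) (-1) ^+ j * kappa X p j|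
  <= expansion_const k.+1 k L * (delta X p 1 + Delta X p k.+1).
Proof.
move=> ell1 ellM L0 LL ph pL.
have growth V : connected_set (@dep _ X) V -> (#|V| <= k.+1)%N ->
    \sum_(j in neighbours (@dep _ X) V) moment (j |: V) <= L * moment V.
  move=> cV Vk; rewrite -[leLHS]lambdaM; apply: ler_wpM2r; first exact: moment_ge0.
  apply: le_trans LL; apply: lambda_le_Lambda; rewrite Vk andbT card_gt0.
  by case/andP: cV.
have pm0 : 0 <= max_prob p by apply: bigmax_ge_id.
have half V : connected_set (@dep _ X) V -> (#|V| <= k.+1)%N ->
    \sum_(j in neighbours (@dep _ X) V) moment [set j] <= 1 / 2.
  move=> cV Vk; rewrite -(ler_pM2r (moment_gt0 V)) mulr_suml.
  apply: (@le_trans _ _ (max_prob p * (L * moment V))); last first.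
    by rewrite mulrA; apply: ler_wpM2r => //; apply: moment_ge0.
  apply: le_trans (ler_wpM2l pm0 (growth V cV Vk)); rewrite mulr_sumr.
  by apply: ler_sum => j jV; apply: moment_boundary.
rewrite Pr_no_edge sum_kappaE deltaE.
have := log_avoid_bound dep_sym moment0 moment_ge0 moment_sup moment_indep
  avoid_moment_ge0 avoid_moment_le (fun i => le_trans (moment1_le_max i) ph)
  half ell1 ellM (ltnSn k) L0 growth.
congr (_ <= _ * (_ + _)); apply: eq_bigl => V; by rewrite inE.
Qed.

(** The empty outcome has positive weight and contains no edge, as edges are nonempty. *)
Lemma Pr_no_edge_gt0 : 0 < Pr p (fun S => num_edges_in X S == 0%N).
Proof.
have e0 : num_edges_in X set0 == 0%N.
  rewrite cards_eq0; apply/set0Pn => -[g]; rewrite inE subset0 => /andP[gX /eqP g0].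
  by have := X_nonempty gX; rewrite g0 cards0.
rewrite /Pr (bigD1 set0) //= ltr_pwDl //; last first.
  by apply: sumr_ge0 => S _; apply: weight_ge0.
rewrite /weight big_set0 mul1r; apply: prodr_gt0 => w _.
by rewrite subr_gt0; case/andP: (p01 w).
Qed.

End Hypergraph.

(* The real logarithm and the limit statement *)
From mathcomp Require Import all_classical all_reals all_analysis.

Import Order.TTheory GRing.Theory Num.Theory.
Import numFieldNormedType.Exports.
Local Open Scope classical_set_scope.
Local Open Scope ring_scope.

(** Both sides come from ln(1 + y) <= y, taken at y = -x and, for the inverse of 1 - x, at y = x /
    (1 - x). *)
Lemma ln_step_bound (R : realType) (z x : R) : 0 < z -> 0 <= x <= 1 / 2 ->
  `|ln (z * (1 - x)) - ln z + x| <= 2 * x ^+ 2.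
Proof.
move=> z0 /andP[x0 xh].
have y0 : 0 < 1 - x by lra.
have yn0 : 1 - x != 0 by rewrite gt_eqF.
rewrite lnM ?posrE // [ln z + _]addrC addrK.
have up : ln (1 - x) <= - x by apply: le_ln1Dx; lra.
have q0 : 0 <= x / (1 - x) by rewrite divr_ge0 // ltW.
have lo : - ln (1 - x) <= x / (1 - x).
  rewrite -lnV ?posrE //.
  have e : (1 - x)^-1 = 1 + x / (1 - x) by field.
  by rewrite [in leLHS]e; apply: le_ln1Dx; lra.
have qx : x / (1 - x) <= x + 2 * x ^+ 2 by rewrite ler_pdivrMr //; nra.
by rewrite ler_norml; apply/andP; split; nra.
Qed.

Lemma limn_esup_near_le (R : realType) (u : nat -> R) :
  (limn_esup (fun n => (u n)%:E) < +oo)%E ->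
  exists L : R, \forall n \near \oo, u n <= L.
Proof.
rewrite /limn_esup /limf_esup => /ereal_inf_lt[_ [V ooV <-]] sV.
have [L LV] : exists L : R, (ereal_sup [set (u n)%:E | n in V] <= L%:E)%E.
  (* The supremum is finite or minus infinity; in the latter case 0 serves as bound. *)
  by case: (ereal_sup _) sV => [r _|//|_]; [exists r | exists 0; rewrite leNye].
exists L; apply: filterS ooV => n Vn; rewrite -lee_fin; apply: le_trans LV.
by apply: ereal_sup_ubound; exists n.
Qed.

Theorem theorem1p9 (R : realType) (Omega : nat -> finType)
    (X : forall n : nat, {set {set Omega n}})
    (p : forall n : nat, Omega n -> R)
    (X_nonempty : forall (n : nat) (g : {set Omega n}), g \in X n -> (0 < #|g|)%N)
    (p01 : forall (n : nat) (w : Omega n), 0 < p n w < 1)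
    (p_to0 : (fun n : nat => max_prob (p n)) @ \oo --> (0 : R))
    (Lambda_bounded : forall k : nat,
       (limn_esup (fun n : nat => (Lambda (X n) (p n) k)%:E) < +oo)%E)
    (k : nat) :
  exists err : nat -> R,
    err =O_\oo (fun n : nat => delta (X n) (p n) 1 + Delta (X n) (p n) k.+1) /\
    \forall n \near \oo,
      Pr (p n) (fun S : {set Omega n} => num_edges_in (X n) S == 0%N) =
      expR (\sum_(1 <= j < k.+1) (-1) ^+ j * kappa (X n) (p n) j + err n).
Proof.
have [L0 hL0] := limn_esup_near_le (Lambda_bounded k.+1).
pose L := Num.max 0 L0.
have L_ge0 : 0 <= L by rewrite le_max lexx.
pose C := expansion_const k.+1 k L.
have C_gt0 : 0 < C.
  rewrite /C /expansion_const ltr_pwDl ?mulr_ge0 ?exprn_ge0 ?cumulant_const_ge0 //.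
    by rewrite ltr_pwDl // exprn_ge0 // ltW // remainder_const_gt0.
  by apply: sumr_ge0 => s _; apply: exprn_ge0.
(* With the error defined as the exact difference of logarithms, the equation holds for every [n],
   and only the bound is asymptotic. *)
pose err n := ln (Pr (p n) (fun S => num_edges_in (X n) S == 0%N))
              - \sum_(1 <= j < k.+1) (-1) ^+ j * kappa (X n) (p n) j.
exists err; split; last first.
  apply: nearW => n; rewrite /err addrC subrK lnK // posrE.
  exact: Pr_no_edge_gt0 (p01 n) (X_nonempty n).
apply/eqO_exP; exists C => //.
(* Chosen so that [eps] and [eps * L] are both at most 1/2. *)
pose eps : R := (2 * (1 + L))^-1.
have eps0 : 0 < eps by rewrite invr_gt0; lra.
have hp : \forall n \near \oo, max_prob (p n) <= eps.
  move/cvgrPdist_le: p_to0 => /(_ _ eps0); apply: filterS => n.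
  by rewrite sub0r normrN; apply: le_trans; exact: ler_norm.
have epsE : eps * (1 + L) = 1 / 2.
  have L1 : 1 + L != 0 by rewrite gt_eqF //; lra.
  by rewrite /eps; field.
near=> n.
have pn : max_prob (p n) <= eps by near: n.
have Ln : Lambda (X n) (p n) k.+1 <= L.
  by rewrite le_max; apply/orP; right; near: n.
have D0 : 0 <= delta (X n) (p n) 1 + Delta (X n) (p n) k.+1.
  apply: addr_ge0.
    by rewrite (deltaE _ (p01 n)); apply: sumr_ge0 => i _; apply: sqr_ge0.
  by apply: sumr_ge0 => V _; apply: (moment_ge0 (p01 n)).
rewrite (ger0_norm D0); apply: (log_Pr_no_edge_expansion (p01 n) (@X_nonempty n)
  (ln1 R) (@ln_step_bound R) L_ge0 Ln).
- have := mulr_ge0 (ltW eps0) L_ge0; lra.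
- have := ler_wpM2r L_ge0 pn; lra.
Unshelve. all: by end_near.
Qed.
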